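(* Let $h(r)$, $r\ge0$, be a monotonically increasing function with derivative $h'(r)>0$ for all $r>0$ and with inverse $h^{-1}$. A 1-D SCS with BS density function $\lambda(r)$ and path-loss model $\frac{1}{h(R)}$ is equivalent to a 1-D SCS with BS density function $$\bar\lambda(r)=\lambda(h^{-1}(r))\cdot\frac{d}{dr}h^{-1}(r)$$ and path-loss model $\frac1R$, all other parameters (the joint distribution of transmission power and fading) being the same. Consequently, if the noise powers $\eta$ are the same, the SINRs at the MSs located at the origin of the two SCSs have the same distribution: $$\frac{K_i\Psi_i/h(R_i)}{\sum_{j\ne i}K_j\Psi_j/h(R_j)+\eta}\Bigg|_{\lambda(r)}\;=_{\mathrm{st}}\;\frac{K_i\Psi_i/\tilde R_i}{\sum_{j\neq i}K_j\Psi_j/\tilde R_j+\eta}\Bigg|_{\bar\lambda(r)},$$ where $\{R_j\}$ and $\{\tilde R_j\}$ are the distances of the BSs from the MS in the SCSs with densities $\lambda$ and $\bar\lambda$ respectively, $i$ denotes in each system the index of the serving BS, and $=_{\mathrm{st}}$ denotes equality in distribution.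
   Context: A 1-D SCS (shotgun cellular system) with one-sided BS density function $\lambda(r)$, $r\ge 0$, has base stations (BSs) at the points $R_j$ of a Poisson point process on $[0,\infty)$ with (locally integrable) intensity $\lambda$. The mobile station (MS) is at the origin. With path-loss model $1/h(R)$, the BS at distance $R_j$ is received with power $K_j\Psi_j/h(R_j)$, where the pairs $(K_j,\Psi_j)$ of nonnegative random variables (transmission power, fading factor) are i.i.d. across BSs and independent of the BS locations. The serving BS is the one with the strongest received power. The SINR is the received power of the serving BS divided by the sum of the received powers of all other BSs plus the constant noise power $\eta\ge0$. Two SCSs are equivalent if the joint distribution of the powers received at the MS at the origin from all the BSs is the same in both systems (i.e. the random collections, counted with multiplicity, of received powers have the same law). The density $\bar\lambda$ is understood to be zero outside the range of $h$. *)

(* Defs.v *)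
From HB Require Import structures.
From mathcomp Require Import all_boot all_order all_algebra.
From mathcomp Require Import all_classical all_reals all_analysis.
From mathcomp Require Import measurable_realfun.

Set Implicit Arguments.
Unset Strict Implicit.
Unset Printing Implicit Defensive.

Import Order.TTheory GRing.Theory Num.Theory.
Import numFieldNormedType.Exports.

Local Open Scope classical_set_scope.
Local Open Scope ring_scope.

Section independence.
Context d (T : measurableType d) (R : realType) (P : probability T R).

Definition mutually_independent (I : eqType) (F : I -> set_system T) : Prop :=
  forall (s : seq I) (A : I -> set T), uniq s ->
    (forall i, i \in s -> F i (A i)) ->
    (P (\big[setI/setT]_(i <- s) A i) = \prod_(i <- s) P (A i))%E.

Definition independent2 (F G : set_system T) : Prop :=
  forall A B, F A -> G B -> (P (A `&` B) = P A * P B)%E.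

End independence.

(* A random collection of points, finite or infinite, is a sequence of events
   E and a sequence X: the j-th point exists on the event E j, and is then
   located at X j.  Off E j the value of X j is irrelevant. *)
Section point_processes.
Context d (T : measurableType d) (R : realType) (P : probability T R).
Implicit Types (E : nat -> set T) (X : nat -> T -> R).

(* Number of points in B, with multiplicity, possibly infinite. *)
Definition point_count E X (B : set R) (w : T) : \bar R :=
  (\sum_(0 <= j <oo) (\1_(E j `&` X j @^-1` B) w)%:E)%E.

(* sigma-algebra generated by the existing points *)
Definition points_sigma E X : set_system T :=
  <<s [set A | exists (j : nat) (B : set R),
         measurable B /\ A = E j `&` X j @^-1` B] >>.

(* The third clause is the convention that a Poisson variable of infinite mean
   is almost surely infinite: Lam need not be locally finite.
   In poisson_prob the natural number argument is unused. *)
Definition poisson_process E X (Lam : set R -> \bar R) : Prop :=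
  [/\ forall n (B : 'I_n -> set R),
        (forall i, measurable (B i)) -> trivIset setT B ->
        mutually_independent P
          (fun i => g_sigma_algebra_preimage (point_count E X (B i))),
      forall (B : set R) (k : nat), measurable B -> (Lam B < +oo)%E ->
        P [set w | point_count E X B w = k%:R%:E]
          = poisson_prob (fine (Lam B)) 0 [set k]
    & forall B : set R, measurable B -> Lam B = +oo%E ->
        P [set w | point_count E X B w = +oo%E] = 1%E].

Definition halfline_intensity (lam : R -> R) (B : set R) : \bar R :=
  (\int[lebesgue_measure]_(r in B `&` `[0%R, +oo[) (lam r)%:E)%E.

End point_processes.

(* One-dimensional shotgun cellular system with one-sided base station density
   lam; mu is the joint law of (transmission power, fading factor). *)
Record scs d (T : measurableType d) (R : realType) (P : probability T R)
    (lam : R -> R) (mu : probability (R * R)%type R) := SCS {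
  present : nat -> set T ;
  distance : nat -> {RV P >-> R} ;
  txpower : nat -> {RV P >-> R} ;
  fading : nat -> {RV P >-> R} ;
  mark j w := (txpower j w, fading j w) ;
  measurable_present : forall j, measurable (present j) ;
  distance_ge0 : forall j w, present j w -> 0 <= distance j w ;
  txpower_ge0 : forall j w, 0 <= txpower j w ;
  fading_ge0 : forall j w, 0 <= fading j w ;
  distance_poisson : poisson_process P present distance (halfline_intensity lam) ;
  mark_law : forall j (B : set (R * R)), measurable B ->
    P (mark j @^-1` B) = mu B ;
  mark_independent : mutually_independent P
    (fun j => g_sigma_algebra_preimage (mark j)) ;
  mark_distance_independent : independent2 P
    (points_sigma present distance)
    <<s \bigcup_j g_sigma_algebra_preimage (mark j) >> }.

Section received_powers.
Context d (T : measurableType d) (R : realType) (P : probability T R).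
Context (lam : R -> R) (mu : probability (R * R)%type R).
Variables (S : scs P lam mu) (h : R -> R).

(* received powers under the path-loss model 1/h *)
Definition power (j : nat) (w : T) : R :=
  txpower S j w * fading S j w / h (distance S j w).

Definition power_count : set R -> T -> \bar R := point_count (present S) power.

Definition serving (w : T) (i : nat) : Prop :=
  present S i w /\ forall j, present S j w -> power j w <= power i w.

Definition interference (i : nat) (w : T) : \bar R :=
  (\sum_(0 <= j <oo | j != i) (\1_(present S j) w * power j w)%:E)%E.

(* The interference may be infinite, in which case the quotient is 0; a
   positive power over 0 is +oo. *)
Definition sinr (eta : R) (i : nat) (w : T) : \bar R :=
  ((power i w)%:E / (interference i w + eta%:E))%E.

(* The index of the serving base station is random, and the SINR does not
   depend on its choice in case of ties.  The mass of sinr_law is the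
   probability that some base station attains the strongest power. *)
Definition sinr_law (eta : R) (B : set (\bar R)) : \bar R :=
  P [set w | exists2 i, serving w i & B (sinr eta i w)].

End received_powers.

Section comparison.
Context d1 (T1 : measurableType d1) d2 (T2 : measurableType d2) (R : realType).
Context (P1 : probability T1 R) (P2 : probability T2 R).
Context (lam1 lam2 : R -> R) (mu1 mu2 : probability (R * R)%type R).

(* Equality of the laws of the random counting measures formed by the received
   powers, i.e. of their finite-dimensional distributions. *)
Definition scs_equivalent (S1 : scs P1 lam1 mu1) (h1 : R -> R)
    (S2 : scs P2 lam2 mu2) (h2 : R -> R) : Prop :=
  forall n (B : 'I_n -> set R) (C : 'I_n -> set (\bar R)),
    (forall i, measurable (B i)) -> (forall i, measurable (C i)) ->
    P1 [set w | forall i, C i (power_count S1 h1 (B i) w)]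
      = P2 [set w | forall i, C i (power_count S2 h2 (B i) w)].

Definition same_sinr_law (S1 : scs P1 lam1 mu1) (h1 : R -> R)
    (S2 : scs P2 lam2 mu2) (h2 : R -> R) (eta : R) : Prop :=
  forall B : set (\bar R), measurable B ->
    sinr_law S1 h1 eta B = sinr_law S2 h2 eta B.

End comparison.

(* The density lam(h^-1(r)) (h^-1)'(r) on the range of h, and 0 elsewhere. *)
Definition transformed_density (R : realType) (h hinv lam : R -> R) (r : R) : R :=
  if r \in h @` `[0, +oo[ then lam (hinv r) * derive1 hinv r else 0.

(* Main.v *)
(* By the Poisson property, the counts of points in finitely many sets have
   the same joint law in two processes of equal intensity.  The points hinv(R~)
   of the second system form a Poisson process of intensity lam, by the change
   of variables r = h(s); so both systems become marked Poisson processes of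
   intensity lam on the half-line, with the same powers K Psi / h(R).

   The labels of the points are arbitrary, but the intensity is locally finite,
   so that almost surely the points can be ranked by increasing location.  The
   locations of the ranked points are determined by the counts on the rays
   ]-oo, t], and the marks, being i.i.d. and independent of the labelled points,
   remain i.i.d. after ranking.  Hence the ranked marked sequences have the same
   law, and the power counts and the SINR are measurable functions of the
   sequence which do not depend on the labelling.

   The change of variables only assumes that h is differentiable.  A function
   differentiable on a null set maps it to a null set, as it is Lipschitz on
   countably many pieces; so the image under h of the measure of density lam is
   absolutely continuous.  Its density is the almost everywhere derivative of
   F o hinv, where F is a primitive of lam. *)
Require Import Defs.
From HB Require Import structures.
From mathcomp Require Import all_boot all_order all_algebra.
From mathcomp Require Import all_classical all_reals all_analysis.
From mathcomp Require Import measurable_realfun.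
From mathcomp Require Import lra.

Set Implicit Arguments.
Unset Strict Implicit.
Unset Printing Implicit Defensive.

Import Order.TTheory GRing.Theory Num.Theory.
Import numFieldNormedType.Exports.

Local Open Scope classical_set_scope.
Local Open Scope ring_scope.

(** * Images of Lebesgue null sets *)

Section null_image.
Context {R : realType}.
Notation mu := (@lebesgue_measure R).

Lemma negligible_small_cover (A : set R) :
  (forall e : R, 0 < e -> exists V, [/\ measurable V, A `<=` V & (mu V <= e%:E)%E]) ->
  mu.-negligible A.
Proof.
move=> cov.
have /choice[V HV] : forall n : nat, exists V, [/\ measurable V, A `<=` V &
    (mu V <= (n.+1%:R^-1)%:E)%E].
  by move=> n; apply: cov; rewrite invr_gt0.
have mV n : measurable (V n) by have [] := HV n.
exists (\bigcap_n V n); split; first exact: bigcapT_measurable.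
- suff : (mu (\bigcap_n V n) <= 0)%E.
    by move=> c0; apply/eqP; rewrite eq_le c0/=; exact: measure_ge0.
  apply/lee_addgt0Pr => e e0; rewrite add0e.
  near \oo => n.
  have [_ _] := HV n => Vn.
  have mcap : measurable (\bigcap_n V n) by exact: bigcapT_measurable.
  have capV : \bigcap_n V n `<=` V n by exact: bigcap_inf.
  apply: (@le_trans _ _ (mu (V n))).
    by apply: le_measure => //; rewrite inE; [exact: mcap|exact: mV].
  rewrite (le_trans Vn)// lee_fin ltW//.
  by near: n; exact: near_infty_natSinv_lt (PosNum e0).
- by move=> x Ax n _; have [_ + _] := HV n; apply.
Unshelve. all: by end_near. Qed.

(** A cover by open intervals of total length below [e / (2 * C)] is transported piece by piece. The
    image of the part of [S] in [F k] lies within [C * w k] of any one of its values, hence in an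
    interval of length [2 * C * w k]. *)
Lemma negligible_lipschitz_image (f : R -> R) (C : R) (S : set R) : 0 < C ->
  (forall x y, S x -> S y -> `|f x - f y| <= C * `|x - y|) ->
  mu.-negligible S -> mu.-negligible (f @` S).
Proof.
move=> C0 lipf [N [mN N0 SN]]; apply: negligible_small_cover => e e0.
have C2 : 0 < 2 * C by rewrite mulr_gt0.
have : mu N = ereal_inf
    [set (\sum_(0 <= k <oo) wlength idfun (F k))%E | F in open_itv_cover N].
  exact: (outer_measure_open_itv_cover N).
rewrite N0 => inf0.
have [] := @lb_ereal_inf_adherent R
  [set (\sum_(0 <= k <oo) wlength idfun (F k))%E | F in open_itv_cover N]
  (e / (2 * C)) _ _.
- by rewrite divr_gt0.
- by rewrite -inf0.
move=> _ [F [Fitv NF] <-]; rewrite -inf0 add0e => Flt.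
have wF k : (0 <= wlength idfun (F k))%E by exact: wlength_ge0.
have wFfin k : wlength idfun (F k) \is a fin_num.
  rewrite ge0_fin_numE// (le_lt_trans _ (lt_trans Flt (ltry _)))//.
  by rewrite (@nneseriesD1 _ _ k)// leeDl// nneseries_ge0.
pose w k := fine (wlength idfun (F k)).
have Fdist k x y : F k x -> F k y -> `|x - y| <= w k.
  have [[a b] /= Fk] := Fitv k.
  rewrite /w Fk => /= /[!in_itv]/= /andP[ax xb] /andP[ay yb].
  rewrite wlength_itv/= lte_fin (lt_trans ax xb) /= ler_norml.
  by apply/andP; split; lra.
have /choice[G HG] : forall k, exists G, [/\ measurable G,
    (f @` (S `&` F k)) `<=` G & (mu G <= (2 * C * w k)%:E)%E].
  move=> k; have [[s [Ss Fs]]|/forallNP Nex] := pselect (exists s, S s /\ F k s).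
    exists `[f s - C * w k, f s + C * w k]%classic; split => //.
      move=> _ [x [Sx Fx] <-] /=; rewrite in_itv/=.
      have := le_trans (lipf _ _ Sx Ss) (ler_wpM2l (ltW C0) (Fdist k _ _ Fx Fs)).
      by rewrite ler_norml => /andP[? ?]; apply/andP; split; lra.
    have w0 : 0 <= w k by exact: fine_ge0.
    rewrite lebesgue_measure_itv/= lte_fin; case: ifP => _.
      by rewrite -EFinD lee_fin; lra.
    by rewrite lee_fin mulr_ge0// ltW.
  exists set0; split => //; first by move=> ? [x SFx _]; exfalso; exact: (Nex x SFx).
  by rewrite measure0 lee_fin mulr_ge0 ?(ltW C2)//; exact: fine_ge0.
exists (\bigcup_k G k); split.
- by apply: bigcupT_measurable => k; have [] := HG k.
- move=> _ [x Sx <-]; have [k _ Fkx] := NF _ (SN _ Sx).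
  by exists k => //; have [_ + _] := HG k; apply; exists x.
- apply: (@le_trans _ _ (\sum_(0 <= k <oo) mu (G k))%E).
    apply: measure_sigma_subadditive => //.
      by move=> k; have [] := HG k.
    by apply: bigcupT_measurable => k; have [] := HG k.
  apply: (@le_trans _ _ (\sum_(0 <= k <oo) ((2 * C)%:E * wlength idfun (F k)))%E).
    apply: lee_nneseries => // k _; have [_ _] := HG k.
    by move=> /le_trans; apply; rewrite EFinM fineK.
  rewrite nneseriesZl//.
  have -> : (e%:E = (2 * C)%:E * (e / (2 * C))%:E)%E.
    by rewrite -EFinM mulrC divfK ?gt_eqF.
  by rewrite lee_pmul2l// ltW.
Qed.

(** On [P n] the function satisfies a Lipschitz bound with constant [n.+1] at scale [1 / n.+1].
    Cutting [P n] into cells [Q n m] shorter than that scale, indexed by an encoded integer part,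
    makes the bound hold between any two points of a cell. Countably many cells cover [D]. *)
Lemma negligible_derivable_image (f : R -> R) (D : set R) :
  (forall x, D x -> derivable f x 1) -> mu.-negligible D ->
  mu.-negligible (f @` D).
Proof.
move=> df D0.
pose P n := [set x | D x /\ forall y, `|y - x| < n.+1%:R^-1 ->
  `|f y - f x| <= n.+1%:R * `|y - x|].
pose Q n m := [set x | P n x /\ unpickle m = Some (Num.floor (x * n.+1%:R))].
apply: (@negligibleS _ _ R mu (\bigcup_n \bigcup_m f @` Q n m)); last first.
  apply: negligible_bigcup => n; apply: negligible_bigcup => m.
  apply: (@negligible_lipschitz_image _ n.+1%:R); first by [].
    move=> x y [[Dx Px] xm] [[Dy Py] ym]; apply: Py.
    have : Num.floor (x * n.+1%:R) = Num.floor (y * n.+1%:R).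
      by move: ym; rewrite xm => -[].
    move=> fxy; have := ge_floor (x * n.+1%:R); have := ge_floor (y * n.+1%:R).
    have := lt_succ_floor (x * n.+1%:R); have := lt_succ_floor (y * n.+1%:R).
    rewrite fxy !intrD => h1 h2 h3 h4.
    rewrite -(ltr_pM2r (ltr0Sn _ n)) mulVf// -[X in _ * X]ger0_norm// -normrM.
    by rewrite mulrBl ltr_norml; apply/andP; split; lra.
  by apply: negligibleS D0 => x [[]].
move=> _ [x Dx <-].
have /derivableP/is_derive1_caratheodory[g [gE cg gx]] := df _ Dx.
have /cvgrPdist_lt/(_ 1 ltr01)[/= d d0 gd] := cg.
(* With [g] the Caratheodory slope of [f] at [x], this [n] gives both [1 / n.+1 <= d], so that [g y]
   is within 1 of [g x], and [n.+1 > |g x| + 1], which bounds the slope. *)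
pose n := maxn (Num.truncn d^-1) (Num.truncn (`|g x| + 1)).
exists n => //; exists (pickle (Num.floor (x * n.+1%:R))) => //; exists x => //.
split; last by rewrite pickleK.
split => // y yx; rewrite gE normrM ler_wpM2r//.
have yd : `|x - y| < d.
  rewrite distrC (lt_le_trans yx)// -[leRHS]invrK lef_pV2 ?posrE ?invr_gt0//.
  rewrite ltW// (lt_le_trans (truncnS_gt _))// ler_nat ltnS leq_maxl//.
have := gd _ yd; rewrite distrC => /ltW gy.
have : `|g y| <= `|g x| + 1.
  by rewrite -[g y](subrK (g x)) (le_trans (ler_normD _ _))// addrC lerD2l.
move=> /le_trans; apply; rewrite ltW// (lt_le_trans (truncnS_gt _))//.
by rewrite ler_nat ltnS leq_maxr.
Qed.

End null_image.

(** * Change of variables *)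

Section change_of_variables.
Context {R : realType} (h hinv : R -> R).
Hypothesis h_incr : forall r s : R, 0 <= r -> r < s -> h r < h s.
Hypothesis h_deriv : forall r : R, 0 < r -> derivable h r 1 /\ 0 < derive1 h r.
Hypothesis hinvK : forall r : R, 0 <= r -> hinv (h r) = r.
Notation mu := (@lebesgue_measure R).

Let hmono r s : 0 <= r -> 0 <= s -> (h r < h s) = (r < s).
Proof.
move=> r0 s0; have [rs|sr|->] := ltgtP r s; first exact: h_incr.
- by apply/negbTE; rewrite -leNgt ltW// h_incr.
- by rewrite ltxx.
Qed.

Let h_cont r : 0 < r -> {for r, continuous h}.
Proof.
move=> r0; apply: differentiable_continuous; apply/derivable1_diffP.
by have [] := h_deriv r0.
Qed.

Lemma is_derive_hinv r : 0 < r -> is_derive (h r) (1 : R) hinv (derive1 h r)^-1.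
Proof.
move=> r0; have [dh dh0] := h_deriv r0.
apply: is_derive_inverse.
- by near=> x; apply: hinvK; rewrite ltW//; near: x; exact: lt_nbhsr.
- by near=> x; apply: h_cont; near: x; exact: lt_nbhsr.
- by rewrite derive1E; exact: derivableP.
- by rewrite gt_eqF.
Unshelve. all: by end_near. Qed.

(** [h] is continuous on the segment from [r / 2] to [(r + b) / 2], which stays inside the interval
    and away from 0. By the intermediate value theorem its image fills a neighbourhood of [h r]. *)
Let image_nbhs b r : 0 < r < b -> \forall y \near h r, (h @` `]0, b[) y.
Proof.
move=> /andP[r0 rb]; have r20 : 0 < r / 2 by rewrite divr_gt0.
have rc : r < (r + b) / 2 by lra.
near=> y.
have hy : h (r / 2) < y < h ((r + b) / 2).
  apply/andP; split; near: y.
    by apply: lt_nbhsr; rewrite hmono; lra.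
  by apply: lt_nbhsl; rewrite hmono; lra.
have [] := @IVT _ h (r / 2) ((r + b) / 2) y.
- by lra.
- apply: derivable_within_continuous => x; rewrite in_itv/= => /andP[rx _].
  by have [] := h_deriv (lt_le_trans r20 rx).
- have hl : h (r / 2) <= h ((r + b) / 2) by rewrite ltW// hmono; lra.
  rewrite (min_idPl hl) (max_idPr hl).
  by move/andP : hy => [? ?]; apply/andP; split; exact: ltW.
move=> c; rewrite in_itv/= => /andP[c1 c2] <-; exists c => //=.
by rewrite in_itv/=; apply/andP; split; lra.
Unshelve. all: by end_near. Qed.

Lemma open_image b : open (h @` `]0, b[).
Proof.
by rewrite openE => _ [r /= + <-]; rewrite in_itv/= => /image_nbhs.
Qed.

Lemma measurable_image b : measurable (h @` `]0, b[).
Proof. by apply: open_measurable; exact: open_image. Qed.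

Let measurable_hinv b : measurable_fun (h @` `]0, b[) hinv.
Proof.
apply: open_continuous_measurable_fun; first exact: open_image.
move=> _ /[1!inE] -[r /= + <-]; rewrite in_itv/= => /andP[r0 _].
apply: differentiable_continuous; apply/derivable1_diffP.
by have [] := is_derive_hinv r0.
Qed.

(** The derivative is the pointwise limit of difference quotients with increment [1 / n.+1]. They
    are formed from [G], the extension of [hinv] by 0 off [K], which is measurable on the whole
    line; as [K] is open, the extension does not affect the limit at points of [K]. *)
Let measurable_derive1_hinv b : measurable_fun (h @` `]0, b[) (derive1 hinv).
Proof.
pose K := h @` `]0, b[; pose G := hinv \_ K.
have mG : measurable_fun setT G.
  by apply/(measurable_restrictT _ (measurable_image b)); exact: measurable_hinv.
apply: (@measurable_fun_cvg _ _ _ K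
    (fun n x => n.+1%:R * (G (x + n.+1%:R^-1) - G x) : R) (derive1 hinv : R -> R)).
  move=> n; apply: measurable_funTS; apply: measurable_funM => //.
  apply: measurable_funB => //; apply: measurableT_comp => //.
  exact: measurable_funD.
move=> y Ky; have Ko : \forall z \near y, K z.
  by have := @open_image b; rewrite openE => /(_ _ Ky).
have [r /= r0b ry] := Ky; have r0 : 0 < r by move: r0b; rewrite in_itv => /andP[].
have := is_derive_hinv r0; rewrite ry => dy.
have /is_derive1_caratheodory[g [gE cg gy]] := dy.
have -> : derive1 hinv y = g y by rewrite derive1E gy; have [_ ->] := dy.
have dn0 : y + n.+1%:R^-1 @[n --> \oo] --> y.
  rewrite -[X in _ --> X]addr0; apply: cvgD; first exact: cvg_cst.
  exact: cvg_harmonic.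
have : g (y + n.+1%:R^-1) @[n --> \oo] --> g y.
  by apply: (@cvg_comp _ _ _ (fun n : nat => y + n.+1%:R^-1) g); [exact: dn0|exact: cg].
apply: cvg_trans; apply: near_eq_cvg; near=> n.
rewrite /G !patchE !mem_set//; last first.
  by near: n; exact: (dn0 _ Ko).
by rewrite gE addrAC subrr add0r mulrC divfK.
Unshelve. all: by end_near. Qed.


Variable lam : R -> R.
Hypothesis lam_ge0 : forall r : R, 0 <= r -> 0 <= lam r.
Hypothesis lam_locint : forall b : R, mu.-integrable `[0, b] (EFin \o lam).

(** Constant on the negative half-line, hence nondecreasing on all of [R] and measurable; the
    hypotheses constrain [h] on nonnegative reals only. *)
Let ht (x : R) := h (Num.max x 0).

Let htE x : 0 <= x -> ht x = h x.
Proof. by move=> x0; rewrite /ht (max_idPl x0). Qed.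

Lemma measurable_extension : measurable_fun setT ht.
Proof.
apply: nondecreasing_measurable => // x y xy; rewrite /ht.
have [->|ne] := eqVneq (Num.max x 0) (Num.max y 0); first by [].
rewrite ltW// hmono ?le_max ?lexx ?orbT// lt_neqAle ne/=.
by rewrite ge_max !le_max xy lexx orbT.
Qed.

Section bounded.
Variable b : R.

Let I : set R := `]0, b[.
Let K := h @` I.

Let L := lam \_ I.

Let I_gt0 r : I r -> 0 < r. Proof. by rewrite /I/= in_itv/= => /andP[]. Qed.

Let I_ge0 r : I r -> 0 <= r. Proof. by move/I_gt0/ltW. Qed.

Let mI : measurable I. Proof. exact: measurable_itv. Qed.

Let intI : mu.-integrable I (EFin \o lam).
Proof.
apply: integrableS (lam_locint b) => //.
by move=> x /=; rewrite !in_itv/= => /andP[/ltW-> /ltW->].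
Qed.

Let intL : mu.-integrable setT (EFin \o L).
Proof.
by rewrite /L -restrict_EFin; apply/integrable_restrict => //=; rewrite setTI.
Qed.

Let integral_L (A : set R) : measurable A ->
  (\int[mu]_(t in A) (L t)%:E = \int[mu]_(t in A `&` I) (lam t)%:E)%E.
Proof.
move=> mA; rewrite integral_mkcondr; apply: eq_integral => t _.
by rewrite restrict_EFin.
Qed.

(** The pushforward charge, kept abstract so that only its values are visible below. *)
Let alpha_ex : exists nu : {charge set (measurableTypeR R) -> \bar R},
  forall B, nu B = (\int[mu]_(t in ht @^-1` B) (L t)%:E)%E.
Proof.
exists (@measure_function_pushforward__canonical__charge_Charge _ _
  (measurableTypeR R) (measurableTypeR R) ht R (induced_charge intL) measurable_extension).
by [].
Qed.


Let ht_preimage_measurable (B : set R) : measurable B -> measurable (ht @^-1` B).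
Proof. by move=> mB; rewrite -[X in measurable X]setTI; exact: measurable_extension. Qed.

(** Radon-Nikodym for the pushforward of [L]. For absolute continuity, the part of [I] that [h]
    sends into a null set [B] is contained in the image under [hinv] of the part of [B] in [K], and
    [hinv] is differentiable on [K], so it preserves null sets. *)
Let density_ex : exists2 phi : R -> R, mu.-integrable setT (EFin \o phi) &
  forall B, measurable B ->
    (\int[mu]_(t in B) (phi t)%:E = \int[mu]_(t in ht @^-1` B) (L t)%:E)%E.
Proof.
have [nu nuE] := alpha_ex.
have numu : nu `<< mu.
  apply/null_content_dominatesP => /= B mB B0.
  rewrite nuE integral_L//; last exact: ht_preimage_measurable.
  have [N [mN N0 HN]] : mu.-negligible (hinv @` (B `&` K)).
    apply: negligible_derivable_image.
      move=> _ [_ [r /I_gt0 r0 <-]].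
      by have [] := is_derive_hinv r0.
    by apply: (@negligibleS _ _ _ mu B); [exact: subIsetl|exists B; split].
  have mS : measurable (ht @^-1` B `&` I).
    by apply: measurableI => //; exact: ht_preimage_measurable.
  apply: null_set_integral => //.
    by apply: measurable_funS mI _ (measurable_int _ intI); exact: subIsetr.
  apply/(@negligibleP _ _ _ mu) => //; exists N; split => //.
  move=> t [/= Bt It]; apply: HN; exists (h t); last first.
    exact/hinvK/I_ge0.
  split; last by exists t.
  by move: Bt; rewrite htE//; exact: I_ge0.
exists (fine \o Radon_Nikodym nu mu).
  apply: eq_integrable (Radon_Nikodym_integrable numu) => //.
  by move=> x _ /=; rewrite fineK// Radon_Nikodym_fin_num.
move=> B mB; rewrite -nuE (Radon_Nikodym_integral numu mB).
by apply: eq_integral => x _ /=; rewrite fineK// Radon_Nikodym_fin_num.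
Qed.

Let K_range : K `<=` h @` `[0, +oo[.
Proof.
by move=> _ [r /I_ge0 r0 <-]; exists r => //=; rewrite in_itv/= r0.
Qed.

Lemma transformed_densityE r : r \in I ->
  transformed_density h hinv lam (h r) = lam r * derive1 hinv (h r).
Proof.
move=> /[1!inE] Ir; rewrite /transformed_density mem_set; last first.
  by apply: K_range; exists r.
by rewrite hinvK//; exact: I_ge0.
Qed.

Lemma measurable_transformed_density : measurable_fun K (transformed_density h hinv lam).
Proof.
have mL : measurable_fun setT L.
  by apply/measurable_EFinP; exact: measurable_int intL.
apply: (eq_measurable_fun (fun y => L (hinv y) * derive1 hinv y)).
  move=> _ /[1!inE] -[r Ir <-]; rewrite transformed_densityE ?inE//.
  rewrite hinvK; last exact: I_ge0.
  by rewrite /L patchE mem_set.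
apply: measurable_funM; last exact: measurable_derive1_hinv.
by apply: measurableT_comp => //; exact: measurable_hinv.
Qed.

Let ae_derivable_primitive (f : R -> R) : mu.-integrable setT (EFin \o f) ->
  let F x := \int[mu]_(t in `]-oo, x]) f t in
  {ae mu, forall x, is_derive x (1 : R) F (f x)}.
Proof.
move=> intf F.
have : {ae mu, forall x, derivable F x 1 /\ derive1 F x = f x}.
  apply: FTC1Ny; first by move=> y; exact: integrableS intf.
  by apply: open_integrable_locally => //; exact: openT.
apply: filterS; first exact: (ae_filter_ringOfSetsType mu).
move=> x [dF Fx]; split => //.
by rewrite -derive1E.
Qed.

(** Two derivatives of one function are compared. The primitive [Phi] of the density [phi] coincides
    on [K] with the primitive of [L] composed with [hinv]. Almost everywhere the former has
    derivative [phi] by Lebesgue differentiation, and the latter has derivative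
    [lam (hinv y) * hinv' y] by the chain rule. *)
Lemma change_of_variables_bounded (B : set R) : measurable B ->
  (\int[mu]_(t in ht @^-1` B `&` I) (lam t)%:E =
   \int[mu]_(y in B `&` K) (transformed_density h hinv lam y)%:E)%E.
Proof.
move=> mB; have [phi intphi phiE] := density_ex.
have mK : measurable K by exact: measurable_image.
have mBK : measurable (B `&` K) by exact: measurableI.
have -> : ht @^-1` B `&` I = ht @^-1` (B `&` K) `&` I.
  apply/seteqP; split=> t [/= Bt It]; split => //; last by case: Bt.
  by split => //; exists t => //; rewrite htE//; exact: I_ge0.
rewrite -integral_L; last exact: ht_preimage_measurable.
rewrite -phiE//; apply: ae_eq_integral => //.
- by apply: measurable_funTS; exact: measurable_int intphi.
- by apply/measurable_EFinP; apply: measurable_funS measurable_transformed_density.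
have /= aephi := ae_derivable_primitive intphi.
have /= aeL := ae_derivable_primitive intL.
pose Phi (x : R) := \int[mu]_(t in `]-oo, x]) phi t.
pose F (x : R) := \int[mu]_(t in `]-oo, x]) L t.
rewrite -/Phi in aephi; rewrite -/F in aeL.
(* Since [h] is increasing, on [I] the condition [h t <= h r] reads [t <= r], and both primitives
   integrate [lam] over the same set. *)
have PhiE r : I r -> Phi (h r) = F r.
  move=> Ir; rewrite /Phi /F /Rintegral phiE//; congr fine.
  rewrite integral_L; last exact: ht_preimage_measurable.
  rewrite integral_L//; congr (integral _ _ _).
  apply/seteqP; split=> t [] /= tr It; split => //; move: tr;
    by rewrite !in_itv/= (htE (I_ge0 It)) !leNgt hmono ?I_ge0.
(* The points of [I] where [F] fails to have derivative [L], carried over by [h]; differentiability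
   of [h] on [I] keeps this set null. *)
pose bad := h @` (~` [set x | is_derive x (1 : R) F (L x)] `&` I).
have bad0 : mu.-negligible bad.
  apply: negligible_derivable_image.
    move=> x [_ /I_gt0 x0].
    by have [] := h_deriv x0.
  by apply: negligibleS aeL; exact: subIsetl.
apply: negligibleS (negligibleU aephi bad0).
move=> y /= /not_implyP[[By [r Ir ry]] neq]; subst y.
apply: contrapT => /not_orP[/contrapT dPhi nbad].
have dF : is_derive r (1 : R) F (L r).
  by apply: contrapT => nd; apply: nbad; exists r.
apply: neq.
have r0b : 0 < r < b by move: Ir; rewrite /I/= in_itv.
have r0 : 0 < r by exact: I_gt0.
have Lr : L r = lam r by rewrite /L patchE mem_set.
have dh := is_derive_hinv r0.
have dFh : is_derive (h r) (1 : R) (F \o hinv) (L r * (derive1 h r)^-1).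
  by apply: is_derive1_comp; rewrite hinvK ?ltW.
have : is_derive (h r) (1 : R) Phi (L r * (derive1 h r)^-1).
  apply: near_eq_is_derive dFh.
  have := image_nbhs r0b; apply: filterS => _ [s Is <-] /=.
  by rewrite PhiE// hinvK//; exact: I_ge0.
case=> _ e1; case: dPhi => _ e2; case: dh => _ e3.
by congr EFin; rewrite transformed_densityE ?inE// derive1E e3 -Lr -e2 e1.
Qed.

End bounded.

Lemma transformed_density_ge0 r : 0 < r -> 0 <= transformed_density h hinv lam (h r).
Proof.
move=> r0; have [_ dh0] := h_deriv r0; have [_ e3] := is_derive_hinv r0.
rewrite (@transformed_densityE (r + 1)); last by rewrite inE /= in_itv/= r0 ltrDl ltr01.
by rewrite derive1E e3 mulr_ge0 ?lam_ge0 ?invr_ge0 ?ltW.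
Qed.

Lemma integral_setU1 (f : R -> \bar R) (D : set R) (p : R) : measurable D ->
  measurable_fun D f -> (\int[mu]_(x in p |` D) f x = \int[mu]_(x in D) f x)%E.
Proof.
move=> mD mf; rewrite integral_mkcond [RHS]integral_mkcond.
have mp : measurable [set p] by exact: measurable_set1.
apply: ae_eq_integral => //.
- apply/(measurable_restrictT _ _).1; first exact: measurableU.
  by apply/measurable_funU => //; split => //; exact: measurable_fun_set1.
- exact/(measurable_restrictT _ _).1.
exists [set p]; split => //; first exact: lebesgue_measure_set1.
move=> x /= /not_implyP[_]; rewrite !patchE => neq.
apply: contrapT => xp; apply: neq.
have -> : (x \in p |` D) = (x \in D); last by [].
by apply/idP/idP => /[!inE]; [case|right].
Qed.

(** The origin is split off because [h] is assumed differentiable only at positive points, and it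
    may jump at 0. The rest is exhausted by the bounded intervals already treated. *)
Let setI_ray (A : set R) : A `&` `[0, +oo[ =
  (if 0 \in A then [set 0] else set0) `|` \bigcup_n (A `&` `]0, n%:R[).
Proof.
apply/seteqP; split=> x.
  move=> [Ax]; rewrite /= in_itv/= andbT le_eqVlt => /predU1P[x0|x0].
    by left; move: Ax; rewrite -x0 => A0; rewrite mem_set.
  right; exists (Num.truncn x).+1 => //; split => //=.
  by rewrite in_itv/= x0/= truncnS_gt.
case; last by move=> [n _ [Ax /= /[!in_itv]/= /andP[/ltW x0 _]]]; rewrite andbT.
by case: ifPn => // /[1!inE] A0 ->; split => //=; rewrite in_itv/= lexx.
Qed.

Let image_bounded (A : set R) n : h @` (A `&` `]0, n%:R[) =
  (h @` `]0, n%:R[) `&` hinv @^-1` A.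
Proof.
apply/seteqP; split=> [_ [r [Ar r0n] <-]|_ [[r r0n <-] /= Ar]].
  by split; [exists r|rewrite /= hinvK//; move: r0n; rewrite /= in_itv/= => /andP[/ltW]].
have r0 : 0 <= r by move: r0n; rewrite /= in_itv/= => /andP[/ltW].
by exists r => //; split => //; move: Ar; rewrite hinvK.
Qed.

Let measurable_image_bounded (A : set R) n : measurable A ->
  measurable (h @` (A `&` `]0, n%:R[)).
Proof.
by move=> mA; rewrite image_bounded; apply: measurable_hinv => //; exact: measurable_image.
Qed.

Let image_ray (A : set R) : h @` (A `&` `[0, +oo[) =
  (if 0 \in A then [set h 0] else set0) `|` \bigcup_n h @` (A `&` `]0, n%:R[).
Proof.
rewrite setI_ray image_setU image_bigcup; congr (_ `|` _).
by case: ifP => _; [exact: image_set1|exact: image_set0].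
Qed.

Lemma measurable_image_ray (A : set R) : measurable A ->
  measurable (h @` (A `&` `[0, +oo[)).
Proof.
move=> mA; rewrite image_ray; apply: measurableU; first by case: ifP.
by apply: bigcupT_measurable => n; exact: measurable_image_bounded.
Qed.

Let integral_bounded (A : set R) n : measurable A ->
  (\int[mu]_(t in A `&` `]0%R, n%:R%R[) (lam t)%:E =
   \int[mu]_(y in h @` (A `&` `]0%R, n%:R%R[))
     (transformed_density h hinv lam y)%:E)%E.
Proof.
move=> mA; have mB := measurable_image_bounded n mA.
have sub : h @` (A `&` `]0, n%:R[) `<=` h @` `]0, n%:R[.
  by apply: image_subset; exact: subIsetr.
have := change_of_variables_bounded n%:R mB.
rewrite (setIidl sub).
move=> <-; congr (integral _ _ _); apply/seteqP; split=> [t [At It]|t [/= [r [Ar Ir] hrt] It]].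
  by split => //; exists t => //; rewrite htE//; move: It; rewrite /= in_itv/= => /andP[/ltW].
split => //; have <- : r = t; last by [].
have r0 : 0 <= r by move: Ir; rewrite /= in_itv/= => /andP[/ltW].
have t0 : 0 <= t by move: It; rewrite /= in_itv/= => /andP[/ltW].
by rewrite -(hinvK r0) hrt htE// hinvK.
Qed.

Hypothesis h_ge0 : forall r : R, 0 <= r -> 0 <= h r.

Lemma halfline_intensity_image (A : set R) : measurable A ->
  halfline_intensity (transformed_density h hinv lam) (h @` (A `&` `[0, +oo[)) =
  halfline_intensity lam A.
Proof.
move=> mA; rewrite /halfline_intensity [in LHS]setIidl; last first.
  by move=> _ [r [_ /=]] /[!in_itv]/= /[!andbT] r0 <-; exact: h_ge0.
have ndI : {homo (fun n => A `&` `]0%R, n%:R[) : n m / (n <= m)%N >-> (n <= m)%O}.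
  move=> n m nm; apply/subsetPset => x [Ax /=]; rewrite !in_itv/= => /andP[-> xn].
  by split => //; rewrite (lt_le_trans xn)// ler_nat.
have mI n : measurable (A `&` `]0%R, n%:R[) by exact: measurableI.
have ndK : {homo (fun n => h @` (A `&` `]0%R, n%:R[)) : n m / (n <= m)%N >-> (n <= m)%O}.
  by move=> n m /ndI/subsetPset nm; apply/subsetPset; exact: image_subset.
have mlam n : measurable_fun (A `&` `]0%R, n%:R[) (EFin \o lam).
  apply: measurable_funS (measurable_int _ (lam_locint n%:R)) => //.
  by move=> x [_ /=]; rewrite !in_itv/= => /andP[/ltW-> /ltW->].
have mtd n : measurable_fun (h @` (A `&` `]0%R, n%:R[))
    (EFin \o transformed_density h hinv lam).
  apply/measurable_EFinP; apply: measurable_funS (@measurable_transformed_density n%:R).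
    exact: measurable_image.
  by apply: image_subset; exact: subIsetr.
(* The origin, or its image [h 0], is a single point and does not change a Lebesgue integral. *)
have drop1 (f : R -> \bar R) (p : R) (D : (set R)^nat) :
    (forall n, measurable (D n)) -> (forall n, measurable_fun (D n) f) ->
    (\int[mu]_(x in (if 0%R \in A then [set p] else set0) `|` \bigcup_n D n) f x =
    \int[mu]_(x in \bigcup_n D n) f x)%E.
  move=> mD mf; case: ifP => _; last by rewrite set0U.
  apply: integral_setU1; first exact: bigcupT_measurable.
  by apply/measurable_fun_bigcup.
rewrite image_ray setI_ray !drop1//; last first.
  by move=> n; exact: measurable_image_bounded.
have lam_pos n x : (A `&` `]0, n%:R[) x -> (0 <= (EFin \o lam) x)%E.
  move=> [_ /=]; rewrite in_itv/= => /andP[x0 _].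
  by rewrite lee_fin lam_ge0// ltW.
have td_pos n x : (h @` (A `&` `]0, n%:R[)) x ->
    (0 <= (EFin \o transformed_density h hinv lam) x)%E.
  move=> [r [_ /= +] <-]; rewrite in_itv/= => /andP[r0 _].
  by rewrite lee_fin transformed_density_ge0.
(* Monotone convergence along the intervals on one side and along their images on the other; the two
   sequences of integrals agree term by term by [integral_bounded]. *)
have cvg1 := @ge0_nondecreasing_set_cvg_integral _ (measurableTypeR R) R _
  (EFin \o lam) mu ndI mI mlam lam_pos.
have cvg2 := @ge0_nondecreasing_set_cvg_integral _ (measurableTypeR R) R _
  (EFin \o transformed_density h hinv lam) mu ndK
  (fun n => measurable_image_bounded n mA) mtd td_pos.
apply: etrans; first exact: (esym (cvg_lim (@ereal_hausdorff R) cvg2)).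
apply: etrans; last exact: (cvg_lim (@ereal_hausdorff R) cvg1).
by congr (lim (_ @ \oo)); apply/funext => n; exact/esym/integral_bounded.
Qed.

Lemma halfline_intensity_out : halfline_intensity
  (transformed_density h hinv lam) (~` (h @` `[0, +oo[)) = 0%E.
Proof.
rewrite /halfline_intensity; apply: integral0_eq => x [Kx _].
by rewrite /transformed_density memNset.
Qed.

End change_of_variables.

(** * Counts of Poisson processes *)

(** Values of counts are coded by the countable type [option nat], with [None] for infinity, so that
    events on finitely many counts split into countably many cases. *)
Definition count_value (R : realType) (v : option nat) : \bar R :=
  if v is Some k then k%:R%:E else +oo%E.

Lemma count_value_inj (R : realType) : injective (@count_value R).
Proof. by move=> [k|] [k'|] //= [] /eqP; rewrite eqr_nat => /eqP ->. Qed.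

Section point_count.
Context d (T : measurableType d) (R : realType).
Variables (E : nat -> set T) (X : nat -> T -> R).

Lemma nneseries_indic_counting (D : nat -> set T) w :
  (\sum_(0 <= j <oo) (\1_(D j) w)%:E)%E = counting [set j | D j w] :> \bar R.
Proof.
rewrite counting_dirac; apply: eq_eseriesr => j _.
by rewrite diracE indicE.
Qed.

Lemma point_countE B w :
  point_count E X B w = counting [set j | E j w /\ B (X j w)].
Proof. exact: nneseries_indic_counting. Qed.

Lemma point_count_value B w : exists v, point_count E X B w = count_value R v.
Proof.
rewrite point_countE /counting.
by case: ifP => _; [eexists (Some _)|exists None].
Qed.

Lemma measurable_point_count B : (forall j, measurable (E j `&` X j @^-1` B)) ->
  measurable_fun setT (point_count E X B).
Proof.
move=> mEX; apply: ge0_emeasurable_sum => [j w _ _|j _]; first by rewrite lee_fin.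
by apply/measurable_EFinP; exact: measurable_indic.
Qed.

Lemma point_count_bigcup (I : finType) (Q : pred I) (B : I -> set R) w :
  (forall i i' x, B i x -> B i' x -> i = i') ->
  point_count E X [set x | exists2 i, Q i & B i x] w =
  (\sum_(i | Q i) point_count E X (B i) w)%E.
Proof.
move=> trivB; rewrite /point_count -nneseries_sum//.
apply: eq_eseriesr => j _; rewrite sumEFin; congr (_%:E).
rewrite indicE; have [|nEX] := boolP (w \in _).
  rewrite inE => -[Ej [i Qi Bi]]; rewrite (bigD1 i)//= big1 ?addr0.
    by rewrite indicE mem_set.
  move=> i' /andP[_ ne]; rewrite indicE memNset// => -[_ Bi'].
  by move/eqP: ne; apply; exact: trivB Bi' Bi.
rewrite big1// => i Qi; rewrite indicE memNset// => -[Ej Bi].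
by move/negP: nEX; apply; rewrite inE; split => //; exists i.
Qed.

End point_count.

Section poisson_values.
Context d (T : measurableType d) (R : realType) (P : probability T R).
Variables (E : nat -> set T) (X : nat -> T -> R) (Lam : set R -> \bar R).
Hypothesis mEX : forall j B, measurable B -> measurable (E j `&` X j @^-1` B).
Hypothesis poisson : poisson_process P E X Lam.

Lemma measurable_count_value B v : measurable B ->
  measurable [set w | point_count E X B w = count_value R v].
Proof.
move=> mB; rewrite -[X in measurable X]setTI.
apply: (measurable_point_count _ measurableT (emeasurable_set1 (count_value R v))).
by move=> j; exact: mEX.
Qed.

(** The Poisson weights of the finite values already sum to 1, which leaves no mass for an infinite
    count. *)
Lemma poisson_finite B : measurable B -> (Lam B < +oo)%E ->
  P [set w | (point_count E X B w < +oo)%E] = 1%E.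
Proof.
have [_ pk _] := poisson; move=> mB LB.
have -> : [set w | (point_count E X B w < +oo)%E] =
    \bigcup_k [set w | point_count E X B w = count_value R (Some k)].
  apply/seteqP; split=> w /=; last by case=> k _ ->; exact: ltry.
  by have [[k|] e] := point_count_value E X B w; rewrite e// => _; exists k.
rewrite measure_bigcup//; last 2 first.
- by move=> k _; exact: measurable_count_value.
- by move=> k k' _ _ [w [/= e e']]; apply: Some_inj;
    apply: (@count_value_inj R); exact: etrans (esym e) e'.
under eq_eseriesr do rewrite /= pk//.
have := @probability_setT _ _ R (poisson_prob (fine (Lam B)) 0).
have -> : [set: nat] = \bigcup_k [set k] by apply/seteqP; split => // k _; exists k.
rewrite measure_bigcup//; last by move=> k k' _ _ [n [/= -> ->]].
by move=> <-; apply: eq_eseriesl => k; rewrite in_setT mem_set//; exists k.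
Qed.

Definition poisson_value B v : \bar R :=
  match v with
  | Some k => if (Lam B < +oo)%E then poisson_prob (fine (Lam B)) 0 [set k] else 0%E
  | None => if (Lam B < +oo)%E then 0%E else 1%E
  end.

Lemma poisson_valueE B v : measurable B ->
  P [set w | point_count E X B w = count_value R v] = poisson_value B v.
Proof.
move=> mB; have [_ pk poo] := poisson.
have null (A D : set T) : measurable A -> measurable D -> A `<=` ~` D ->
    P D = 1%E -> P A = 0%E.
  move=> mA mD AD D1; apply/eqP; rewrite -measure_le0.
  apply: (@le_trans _ _ (P (~` D))).
    by apply: le_measure; rewrite ?inE//; exact: measurableC.
  by rewrite probability_setC// D1 subee.
rewrite /poisson_value; have [LB|] := ltP (Lam B) +oo%E; last first.
  rewrite leye_eq => /eqP LB; case: v => [k|]; last exact: poo.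
  apply: (null _ [set w | point_count E X B w = count_value R None]).
  - exact: measurable_count_value.
  - exact: measurable_count_value.
  - by move=> w /= -> .
  - exact: poo.
case: v => [k|]; first exact: pk.
apply: (null _ [set w | (point_count E X B w < +oo)%E]).
- exact: measurable_count_value.
- rewrite (_ : mkset _ = ~` [set w | point_count E X B w = count_value R None]).
    by apply: measurableC; exact: measurable_count_value.
  apply/seteqP; split=> w /=; first by move=> + e; rewrite e.
  by have [[k|] e] := point_count_value E X B w; rewrite e// => _; exact: ltry.
- by move=> w /= ->.
- exact: poisson_finite.
Qed.

Lemma poisson_joint_value n (B : 'I_n -> set R) (v : 'I_n -> option nat) :
  (forall i, measurable (B i)) -> trivIset setT B ->
  P [set w | forall i, point_count E X (B i) w = count_value R (v i)] =
  (\prod_(i < n) poisson_value (B i) (v i))%E.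
Proof.
move=> mB tB; have [ind _ _] := poisson.
have := ind n B mB tB (enum 'I_n)
  (fun i => [set w | point_count E X (B i) w = count_value R (v i)]) (enum_uniq _) _.
rewrite !big_enum/=.
rewrite (_ : [set w | forall i, _] =
  \big[setI/setT]_(i < n) [set w | point_count E X (B i) w = count_value R (v i)]).
  move=> ->; first by apply: eq_bigr => i _; exact: poisson_valueE.
  move=> i _; exists [set count_value R (v i)]; first exact: emeasurable_set1.
  by rewrite setTI.
rewrite -bigcap_seq; apply/seteqP; split=> w /= wB i => [_|].
  exact: wB.
by apply: (wB i); rewrite /= mem_index_enum.
Qed.

End poisson_values.

Section poisson_same_counts.
Context d1 (T1 : measurableType d1) d2 (T2 : measurableType d2) (R : realType).
Context (P1 : probability T1 R) (P2 : probability T2 R).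
Variables (E1 : nat -> set T1) (X1 : nat -> T1 -> R).
Variables (E2 : nat -> set T2) (X2 : nat -> T2 -> R) (Lam : set R -> \bar R).
Hypothesis mEX1 : forall j B, measurable B -> measurable (E1 j `&` X1 j @^-1` B).
Hypothesis mEX2 : forall j B, measurable B -> measurable (E2 j `&` X2 j @^-1` B).
Hypothesis poisson1 : poisson_process P1 E1 X1 Lam.
Hypothesis poisson2 : poisson_process P2 E2 X2 Lam.

(* The sets B i are unions of disjoint atoms, to which independence applies; an
   atom is indexed by the function telling which B i contain it. *)
Lemma poisson_same_counts n (B : 'I_n -> set R) (Q : set ('I_n -> \bar R)) :
  (forall i, measurable (B i)) ->
  P1 [set w | Q (fun i => point_count E1 X1 (B i) w)] =
  P2 [set w | Q (fun i => point_count E2 X2 (B i) w)].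
Proof.
move=> mB.
pose sig x : {ffun 'I_n -> bool} := [ffun i => x \in B i].
pose A s : set R := [set x | sig x = s].
have mA s : measurable (A s).
  have -> : A s = \bigcap_(i in [set` 'I_n]) (if s i then B i else ~` B i).
    apply/seteqP; split=> [x <- i _|x xB].
      by rewrite ffunE; case: ifPn => [/set_mem//|/negP + /mem_set]; exact.
    apply/ffunP => i; rewrite ffunE; have := xB i isT.
    by case: (s i) => [/mem_set//|]; exact: memNset.
  apply: fin_bigcap_measurable => // i _.
  by case: ifP => _ //; exact: measurableC.
have BA i : B i = [set x | exists2 s : {ffun 'I_n -> bool}, s i & A s x].
  apply/seteqP; split=> [x /mem_set Bx|x [s si sx]]; first by exists (sig x); rewrite ?ffunE.
  by move: si; rewrite -sx ffunE => /set_mem.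
have tA s s' x : A s x -> A s' x -> s = s' by rewrite /A /= => ->.
pose m := #|{ffun 'I_n -> bool}|.
pose A' (k : 'I_m) := A (enum_val k).
have tA' : trivIset setT A'.
  move=> k k' _ _ [x [Ax Ax']]; apply: enum_val_inj.
  exact: tA Ax Ax'.
have mA' k : measurable (A' k) by exact: mA.
(* The counts of the [B i] recovered by additivity from a vector [v] of counts of atoms. *)
pose cnt (v : {ffun 'I_m -> option nat}) i : \bar R :=
  (\sum_(s : {ffun 'I_n -> bool} | s i) count_value R (v (enum_rank s)))%E.
pose F d (T : measurableType d) (E : nat -> set T) (X : nat -> T -> R) k : set T :=
  if pickle_inv k is Some v then
    [set w | Q (cnt v) /\ forall i, point_count E X (A' i) w = count_value R (v i)]
  else set0.
(* The event splits over the countably many joint values of the counts of atoms, coded by [pickle],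
   so [Q] may be any set. The resulting sum depends on [Lam] and the sets alone and is therefore
   common to both processes. *)
have FE d (T : measurableType d) (P : probability T R) (E : nat -> set T)
    (X : nat -> T -> R)
    (mEX : forall j B, measurable B -> measurable (E j `&` X j @^-1` B))
    (poisson : poisson_process P E X Lam) :
  P [set w | Q (fun i => point_count E X (B i) w)] =
  (\sum_(0 <= k <oo) if pickle_inv k is Some v then
    if `[< Q (cnt v) >] then \prod_(i < m) poisson_value Lam (A' i) (v i) else 0 else 0)%E.
  have cntE w (v : {ffun 'I_m -> option nat}) :
      (forall i, point_count E X (A' i) w = count_value R (v i)) ->
      (fun i => point_count E X (B i) w) = cnt v.
    move=> wv; apply/funext => i; rewrite BA point_count_bigcup//.
    by apply: eq_bigr => s _; rewrite -wv /A' enum_rankK.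
  have mjoint (v : {ffun 'I_m -> option nat}) :
      measurable [set w | forall i, point_count E X (A' i) w = count_value R (v i)].
    rewrite (_ : mkset _ = \bigcap_(i in [set` 'I_m])
      [set w | point_count E X (A' i) w = count_value R (v i)]).
      by apply: fin_bigcap_measurable => // i _; exact: measurable_count_value.
    by apply/seteqP; split=> w /= wv i => [_|]; exact: wv.
  have FQ (v : {ffun 'I_m -> option nat}) :
      [set w | Q (cnt v) /\
         forall i, point_count E X (A' i) w = count_value R (v i)] =
      if `[< Q (cnt v) >]
      then [set w | forall i, point_count E X (A' i) w = count_value R (v i)]
      else set0.
    by case: asboolP => Qv; apply/seteqP; split=> w /=; [case|split|case|].
  have mF k : measurable (F _ _ E X k).
    by rewrite /F; case: pickle_inv => // v; rewrite FQ; case: ifP.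
  have -> : [set w | Q (fun i => point_count E X (B i) w)] = \bigcup_k F _ _ E X k.
    apply/seteqP; split=> w /=; last first.
      by case=> k _; rewrite /F; case: pickle_inv => // v [Qv /cntE ->].
    move=> Qw; have /choice[v wv] i := point_count_value E X (A' i) w.
    exists (pickle (finfun v)) => //; rewrite /F pickleK_inv /=.
    have wv' i : point_count E X (A' i) w = count_value R (finfun v i) by rewrite ffunE.
    by split; [rewrite -(cntE w)|].
  rewrite measure_bigcup//.
    under eq_eseriesl do rewrite in_setT.
    apply: eq_eseriesr => k _; rewrite /F; case: pickle_inv => [v|]; last exact: measure0.
    rewrite FQ; case: ifP => _; last exact: measure0.
    exact: poisson_joint_value.
  move=> k k' _ _ [w []]; rewrite /F.
  have := @pickle_invK {ffun 'I_m -> option nat} k.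
  have := @pickle_invK {ffun 'I_m -> option nat} k'.
  case: (pickle_inv k') => [v'|] /=; last by move=> _ _ _ [].
  move=> <-; case: (pickle_inv k) => [v|] /=; last by move=> _ [].
  move=> <- [_ wv] [_ wv']; congr pickle; apply/ffunP => i.
  by apply: (@count_value_inj R); exact: etrans (esym (wv i)) (wv' i).
by rewrite (FE _ _ _ _ _ mEX1 poisson1) (FE _ _ _ _ _ mEX2 poisson2).
Qed.

End poisson_same_counts.

(** * Ranking the points *)

Section marks.
Context d (T : measurableType d) dV (V : measurableType dV) (R : realType).
Context (P : probability T R) (mu : probability V R).
Variables (S : set_system T) (M : nat -> T -> V).
Hypothesis S_meas : S `<=` measurable.
Hypothesis S_setI : setI_closed S.
Hypothesis mM : forall j, measurable_fun setT (M j).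
Hypothesis M_law : forall j B, measurable B -> P (M j @^-1` B) = mu B.
Hypothesis M_indep : mutually_independent P (fun j => g_sigma_algebra_preimage (M j)).
Hypothesis S_M_indep : independent2 P S
  <<s \bigcup_j g_sigma_algebra_preimage (M j) >>.

Let preimageM j (B : set V) : measurable B -> g_sigma_algebra_preimage (M j) (M j @^-1` B).
Proof. by move=> mB; exists B => //; rewrite setTI. Qed.

Let measurable_preimageM j (B : set V) : measurable B -> measurable (M j @^-1` B).
Proof. by move=> mB; rewrite -[X in measurable X]setTI; exact: mM. Qed.

Let fine_prod (D : nat -> set V) (q : seq nat) : (forall j, measurable (D j)) ->
  (\prod_(j <- q) mu (D j) = (\prod_(j <- q) fine (mu (D j)))%:E)%E.
Proof.
move=> mD; elim: q => [|j q IH]; first by rewrite !big_nil.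
by rewrite !big_cons IH EFinM fineK// fin_num_measure.
Qed.

Let resolved_marks Z q (D : nat -> set V) : S Z -> uniq q ->
  (forall j, measurable (D j)) ->
  P (Z `&` \big[setI/setT]_(j <- q) (M j @^-1` D j)) =
  (P Z * (\prod_(j <- q) fine (mu (D j)))%:E)%E.
Proof.
move=> SZ uq mD; rewrite S_M_indep//; last first.
  set G := \bigcup_j _.
  suff : @measurable _ (g_sigma_algebraType G) (\big[setI/setT]_(j <- q) (M j @^-1` D j)) by [].
  apply: bigsetI_measurable => j _; apply: sub_sigma_algebra.
  by exists j => //; exact: preimageM.
congr (_ * _)%E; rewrite M_indep//; last by move=> j _; exact: preimageM.
by rewrite -fine_prod//; apply: eq_bigr => j _; exact: M_law.
Qed.

(** To be read as: the point of rank [k] carries label [j], possibly with a condition on its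
    location. Such events lie in [S], hence are independent of the marks. *)
Variable L : nat -> nat -> set T.
Hypothesis SL : forall k j, S (L k j).
Hypothesis L_triv : forall k, trivIset setT (L k).
Hypothesis L_inj : forall k k' j, k != k' -> L k j `&` L k' j = set0.
Variable C : nat -> set V.
Hypothesis mC : forall k, measurable (C k).

(* The labels of the points of rank in s are revealed one at a time; q lists
   the labels revealed so far, which do not occur again. *)
Lemma relabelled_marks_rec s q Z (D : nat -> set V) : uniq s -> uniq q -> S Z ->
  (forall j, measurable (D j)) ->
  (forall k j, k \in s -> j \in q -> Z `&` L k j = set0) ->
  P (Z `&` \big[setI/setT]_(j <- q) (M j @^-1` D j) `&`
     \big[setI/setT]_(k <- s) \bigcup_j (L k j `&` M j @^-1` C k)) =
  (P (Z `&` \big[setI/setT]_(k <- s) \bigcup_j L k j) *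
   (\prod_(j <- q) fine (mu (D j)) * \prod_(k <- s) fine (mu (C k)))%:E)%E.
Proof.
elim: s q Z D => [|k s IH] q Z D.
  by move=> _ uq SZ mD _; rewrite !big_nil !setIT mulr1; exact: resolved_marks.
rewrite cons_uniq => /andP[ks us] uq SZ mD disj; rewrite !big_cons.
set Mq := \big[setI/setT]_(j <- q) _.
set rest := \big[setI/setT]_(k0 <- s) \bigcup_j (L k0 j `&` _).
set V' := \big[setI/setT]_(k0 <- s) \bigcup_j _.
(* Both events are split according to the label [j] that has rank [k]. *)
pose F j := Z `&` L k j `&` (M j @^-1` C k `&` Mq) `&` rest.
pose G j := Z `&` L k j `&` V'.
have mL k' j : measurable (L k' j) by exact: S_meas.
have mZ : measurable Z by exact: S_meas.
have mV' : measurable V'.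
  by apply: bigsetI_measurable => k' _; exact: bigcupT_measurable.
have mMq : measurable Mq.
  by apply: bigsetI_measurable => j _; exact: measurable_preimageM.
have mrest : measurable rest.
  apply: bigsetI_measurable => k' _; apply: bigcupT_measurable => j.
  by apply: measurableI => //; exact: measurable_preimageM.
have mF j : measurable (F j).
  rewrite /F; have := @measurable_preimageM j _ (mC k) => mMC.
  by apply: measurableI => //; apply: measurableI; apply: measurableI.
have mG j : measurable (G j) by do 2 apply: measurableI => //.
have -> : Z `&` Mq `&` (\bigcup_j (L k j `&` M j @^-1` C k) `&` rest) = \bigcup_j F j.
  apply/seteqP; split=> w.
    by move=> [[Zw Mqw] [[j _ [Lw Cw]] rw]]; exists j.
  by move=> [j _ [[[Zw Lw] [Cw Mqw]] rw]]; split => //; split => //; exists j.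
have -> : Z `&` (\bigcup_j L k j `&` V') = \bigcup_j G j.
  apply/seteqP; split=> w.
    by move=> [Zw [[j _ Lw] Vw]]; exists j.
  by move=> [j _ [[Zw Lw] Vw]]; split => //; split => //; exists j.
have tF : trivIset setT F.
  move=> j j' _ _ [w [[[[_ Lw] _] _] [[[_ Lw'] _] _]]].
  by apply: (L_triv (k := k)) => //; exists w.
have tG : trivIset setT G.
  move=> j j' _ _ [w [[[_ Lw] _] [[_ Lw'] _]]].
  by apply: (L_triv (k := k)) => //; exists w.
rewrite measure_semi_bigcup//; last exact: bigcupT_measurable.
rewrite measure_semi_bigcup//; last exact: bigcupT_measurable.
rewrite muleC -nneseriesZl//.
apply: eq_eseriesr => j _.
(* A label revealed earlier contributes 0 to both sides, by [disj]. A new label joins [q], with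
   [C k] as the constraint on its mark, and [L k j] joins the event [Z], which stays in [S]. *)
have [jq|jq] := boolP (j \in q).
  by rewrite /F /G disj ?mem_head// !set0I !measure0 mule0.
pose D' j' := if j' == j then C k else D j'.
have DE : \big[setI/setT]_(j' <- j :: q) (M j' @^-1` D' j') = M j @^-1` C k `&` Mq.
  rewrite big_cons /D' eqxx; congr (_ `&` _); apply: eq_big_seq => j' j'q.
  by case: eqP => // e; move: jq; rewrite -e j'q.
have {}IH := IH (j :: q) (Z `&` L k j) D' us; rewrite DE in IH.
apply: etrans; first apply: IH.
- by rewrite cons_uniq jq.
- exact: S_setI.
- by move=> j'; rewrite /D'; case: ifP.
- move=> k' j' k's; rewrite inE => /predU1P[->|j'q].
    rewrite -setIA L_inj ?setI0//.
    by apply: contraNneq ks => ->.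
  by rewrite setIAC disj ?set0I// inE k's orbT.
rewrite muleC; congr (_ * _)%E; congr EFin; rewrite big_cons /D' eqxx.
rewrite [RHS]mulrCA mulrA; congr (_ * _); congr (_ * _).
apply: eq_big_seq => j' j'q.
by case: eqP => // e; move: jq; rewrite -e j'q.
Qed.

Lemma relabelled_marks s : uniq s -> S setT ->
  P (\big[setI/setT]_(k <- s) \bigcup_j (L k j `&` M j @^-1` C k)) =
  (P (\big[setI/setT]_(k <- s) \bigcup_j L k j) *
   (\prod_(k <- s) fine (mu (C k)))%:E)%E.
Proof.
move=> us ST.
have := @relabelled_marks_rec s [::] setT (fun=> setT) us erefl ST (fun=> measurableT).
by rewrite !big_nil !setTI mul1r; apply.
Qed.

End marks.

(** * Ranks by location *)

Section rank.
Context {R : realType}.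
Variables (e : set nat) (x : nat -> R).

(** Breaking ties by the label makes this a strict total order on the existing points even when
    locations coincide. *)
Definition precedes i j := e i /\ (x i < x j \/ x i = x j /\ (i < j)%N).

Definition has_rank k j :=
  e j /\ counting [set i | precedes i j] = k%:R%:E :> \bar R.

Let counting1U (A B : set nat) j : A `<=` B -> B j -> ~ A j ->
  (counting A + 1 <= counting B :> \bar R)%E.
Proof.
move=> AB Bj Aj.
have -> : (1 = counting [set j] :> \bar R)%E.
  by rewrite /counting asboolT// fset_set1 finmap.cardfs1.
rewrite -measureU//; last first.
  by apply/seteqP; split=> // i [/= Ai ij]; apply: Aj; rewrite -ij.
have mnat (D : set nat) : D \in measurable by apply/mem_set.
by apply: le_measure => // i [/AB//|->].
Qed.

Let precedes_trans i j l : precedes i j -> precedes j l -> precedes i l.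
Proof.
move=> [ei ij] [_ jl]; split => //.
case: ij jl => [ij|[ij ij']] [jl|[jl jl']].
- by left; exact: lt_trans jl.
- by left; rewrite -jl.
- by left; rewrite ij.
- by right; rewrite ij; split => //; exact: ltn_trans jl'.
Qed.

Let precedes_irr j : ~ precedes j j.
Proof. by move=> [_ [|[_]]]; [rewrite ltxx|rewrite ltnn]. Qed.

(** Of two distinct existing points one precedes the other, and then has at least one predecessor
    fewer; as [k] is finite, the ranks differ. *)
Lemma has_rank_inj k i j : has_rank k i -> has_rank k j -> i = j.
Proof.
wlog : i j / precedes i j \/ i = j.
  move=> wlg hi hj; have [->//|/eqP ij] := eqVneq i j.
  have [[ei _] [ej _]] := (hi, hj).
  have [xij|xji|xij] := ltgtP (x i) (x j).
  - by apply: wlg => //; left; split => //; left.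
  - by apply/esym; apply: wlg => //; left; split => //; left.
  - have [lij|lji|//] := ltngtP i j.
    + by apply: wlg => //; left; split => //; right.
    + by apply/esym; apply: wlg => //; left; split => //; right.
move=> [ij|//] [_ ci] [_ cj].
have := @counting1U [set l | precedes l i] [set l | precedes l j] i.
rewrite ci cj => /(_ _ ij (@precedes_irr i)).
rewrite -EFinD lee_fin natr1 ler_nat ltnn => H; exfalso.
by have := H (fun l li => precedes_trans li ij).
Qed.

Lemma has_rank_uniq k k' j : has_rank k j -> has_rank k' j -> k = k'.
Proof.
move=> [_ ck] [_ ck']; have [] : k%:R%:E = k'%:R%:E :> \bar R by rewrite -ck -ck'.
by move/eqP; rewrite eqr_nat => /eqP.
Qed.

(** This turns locations of ranked points into counts on rays; ranks start at 0, whence [k.+1]. The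
    points of [D] form an initial segment of the order, so their ranks are distinct and smaller than
    their number [n]. By the pigeonhole principle every [k] below [n] is then attained. *)
Lemma rank_count k t : finite_set [set j | e j /\ x j <= t] ->
  (exists j, has_rank k j /\ x j <= t) <->
  (k.+1%:R%:E <= counting [set j | e j /\ (x j <= t)%R] :> \bar R)%E.
Proof.
move=> fin; set D := [set j | _] in fin *.
have precD j i : D j -> precedes i j -> D i.
  move=> [ej xj] [ei [xij|[xij _]]]; split => //.
    by rewrite (le_trans (ltW xij)).
  by rewrite xij.
split=> [[j [[ej cj] xj]]|kD].
  rewrite -natr1 EFinD -cj; apply: (counting1U (j := j)); last exact: precedes_irr.
    by move=> i; exact: precD.
  by [].
have finp j : D j -> finite_set [set i | precedes i j].
  by move=> Dj; apply: sub_finite_set fin => i; exact: precD.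
pose r j := size (finmap.enum_fset (fset_set [set i | precedes i j])).
have rE j : D j -> has_rank (r j) j.
  by move=> Dj; split; [case: Dj|rewrite /counting asboolT//; exact: finp].
pose n := size (finmap.enum_fset (fset_set D)).
have nE : counting D = n%:R%:E :> \bar R by rewrite /counting asboolT.
have rn j : D j -> (r j < n)%N.
  move=> Dj; have := @counting1U [set i | precedes i j] D j _ Dj (@precedes_irr j).
  rewrite nE (rE j Dj).2 -EFinD lee_fin natr1 ler_nat; apply.
  by move=> i; exact: precD.
have DP j : j \in finmap.enum_fset (fset_set D) -> D j.
  by move=> jD; apply/set_mem; rewrite -in_fset_set.
pose ranks := [seq r j | j <- finmap.enum_fset (fset_set D)].
have [_ eqmem] : (size ranks = size (iota 0 n)) * (ranks =i iota 0 n).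
  apply: uniq_min_size.
  - rewrite map_inj_in_uniq ?finmap.fset_uniq// => i j /DP Di /DP Dj rij.
    by apply: (@has_rank_inj (r i)); [|rewrite rij]; exact: rE.
  - by move=> _ /mapP[j /DP Dj ->]; rewrite mem_iota rn.
  - by rewrite size_map size_iota.
have : k \in iota 0 n by rewrite mem_iota/=; move: kD; rewrite nE lee_fin ler_nat.
rewrite -eqmem => /mapP[j /DP Dj kj]; exists j; rewrite kj; split; first exact: rE.
by case: Dj.
Qed.

End rank.

Lemma eq_probability_as d (T : measurableType d) (R : realType)
    (P : probability T R) (G A B : set T) :
  measurable G -> measurable A -> measurable B -> P G = 1%E ->
  (forall w, G w -> A w <-> B w) -> P A = P B.
Proof.
move=> mG mA mB PG AB.
have H D : measurable D -> P D = P (D `&` G).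
  move=> mD; rewrite (measureDI P mD mG) [X in (X + _)%E](_ : _ = 0%E) ?add0e//.
  apply/eqP; rewrite -measure_le0; apply: (@le_trans _ _ (P (~` G))).
    apply: le_measure; rewrite ?inE; [exact: measurableD|exact: measurableC|].
    by move=> w [].
  by rewrite probability_setC// PG subee.
rewrite (H A mA) (H B mB); congr (P _).
by apply/seteqP; split=> w [Dw Gw]; split => //; have [] := AB w Gw; auto.
Qed.

Section rank_events.
Context d (T : measurableType d) (R : realType).
Variables (E : nat -> set T) (X : nat -> T -> R).

Definition rank_event k j : set T :=
  [set w | has_rank [set i | E i w] (fun i => X i w) k j].

(** A location need not be measurable for this sigma-algebra off the event where its point exists,
    so all comparisons are made where both points exist. Strict inequalities are separated by
    rationals, and ties are what remains after removing both strict inequalities. *)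
Lemma points_sigma_rank k j t :
  points_sigma E X (rank_event k j `&` [set w | X j w <= t]).
Proof.
rewrite /points_sigma; set gen := [set A | _].
pose Tp := g_sigma_algebraType gen.
have mB i B : measurable B -> @measurable _ Tp (E i `&` X i @^-1` B).
  by move=> mB; apply: sub_sigma_algebra; exists i, B.
have mE i : @measurable _ Tp (E i).
  by have := mB i setT measurableT; rewrite preimage_setT setIT.
have mlt i l : @measurable _ Tp [set w | [/\ E i w, E l w & X i w < X l w]].
  rewrite (_ : mkset _ = \bigcup_(q : rat) ((E i `&` X i @^-1` `]-oo, ratr q[) `&`
      (E l `&` X l @^-1` `[ratr q, +oo[))).
    by apply: bigcupT_measurable_rat => q; apply: measurableI; exact: mB.
  apply/seteqP; split=> w /=.
    move=> [Ei El il]; have [q] := rat_in_itvoo il.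
    rewrite in_itv/= => /andP[iq ql]; exists q => //=.
    by rewrite !in_itv/= iq andbT ltW.
  move=> [q _ [[Ei /=]]]; rewrite in_itv/= => iq [El /=].
  by rewrite in_itv/= andbT => ql; split => //; exact: lt_le_trans ql.
pose prec i : set Tp := [set w | E j w /\ precedes [set i | E i w] (fun i => X i w) i j].
have mprec i : @measurable _ Tp (prec i).
  rewrite (_ : prec i = [set w | [/\ E i w, E j w & X i w < X j w]] `|`
     (if (i < j)%N then (E i `&` E j) `\` ([set w | [/\ E i w, E j w & X i w < X j w]] `|`
         [set w | [/\ E j w, E i w & X j w < X i w]]) else set0)).
    apply: measurableU => //; case: ifP => // _; apply: measurableD.
      exact: measurableI.
    exact: measurableU.
  apply/seteqP; split=> w.
    move=> [Ej [Ei [xij|[xij ij]]]]; first by left.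
    by right; rewrite ij; split => // -[[_ _]|[_ _]]; rewrite xij ltxx.
  case=> [[Ei Ej xij]|]; first by split => //; split => //; left.
  case: ifP => // ij [[Ei Ej] /not_orP[nij nji]]; split => //; split => //; right; split => //.
  apply/eqP; rewrite eq_le !leNgt; apply/andP; split; apply/negP => xx.
    by apply: nji.
  by apply: nij.
(* The number of predecessors of [j] where the point [j] exists, and 0 elsewhere; as a countable sum
   of indicators it is measurable. *)
pose S (w : Tp) : \bar R := (\sum_(0 <= i <oo) (\1_(prec i) w)%:E)%E.
have -> : rank_event k j `&` [set w | X j w <= t] =
    (E j `&` X j @^-1` `]-oo, t]) `&` [set w | S w = k%:R%:E].
  have cE w : E j w -> S w =
      counting [set i | precedes [set i | E i w] (fun i => X i w) i j].
    move=> Ej; rewrite /S nneseries_indic_counting; congr counting.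
    by apply/seteqP; split=> i; [case|split].
  apply/seteqP; split=> w.
    by move=> [[Ej ck] xt]; split; [split => //=; rewrite in_itv|rewrite /= cE].
  by move=> [[Ej xt] ck]; split; [split => //; rewrite -cE|move: xt; rewrite /= in_itv].
apply: (@measurableI _ Tp); first exact: mB.
have mS : measurable_fun [set: Tp] S.
  apply: ge0_emeasurable_sum => [i w _ _|i _]; first by rewrite lee_fin.
  by apply/measurable_EFinP; exact: measurable_indic.
rewrite -[X in measurable X]setTI.
exact: (mS measurableT _ (emeasurable_set1 _)).
Qed.

End rank_events.

(** * The space of marked sequences *)

Section sequence_space.
Context (R : realType) dV (V : measurableType dV).

Definition mseq := nat -> bool * (R * V).

Definition point_event (k : nat) (t : R) (C : set V) : set mseq :=
  [set s : mseq | [/\ (s k).1, (s k).2.1 <= t & C (s k).2.2]].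

(** [None] leaves a coordinate free, whereas a constraint forces the point to exist. For ranked
    points, such conditions on the locations translate into lower bounds on counts of rays. *)
Definition cylinder n (c : nat -> option (R * set V)) : set mseq :=
  [set s : mseq | forall k, (k < n)%N ->
     if c k is Some p then point_event k p.1 p.2 s else True].

Definition cylinders : set_system mseq :=
  [set A | exists n c, (forall k p, c k = Some p -> measurable p.2) /\ A = cylinder n c].

(** Needed for the Dynkin argument. Two constraints on one coordinate merge into the smaller
    threshold and the intersection of the sets of marks; each cylinder is first padded with [None]
    beyond its length. *)
Lemma cylinders_setI : setI_closed cylinders.
Proof.
move=> _ _ [n [c [mc ->]]] [n' [c' [mc' ->]]].
pose b k := if (k < n)%N then c k else None.
pose b' k := if (k < n')%N then c' k else None.
pose c'' k := match b k, b' k with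
  | Some p, Some p' => Some (Num.min p.1 p'.1, p.2 `&` p'.2)
  | Some p, None => Some p
  | None, o => o end.
exists (maxn n n'), c''; split.
  move=> k p; rewrite /c''.
  have mb q : b k = Some q -> measurable q.2 by rewrite /b; case: ifP => // _; exact: mc.
  have mb' q : b' k = Some q -> measurable q.2 by rewrite /b'; case: ifP => // _; exact: mc'.
  case: (b k) mb => [q|] mb; case: (b' k) mb' => [q'|] mb' //.
  - by case=> <- /=; apply: measurableI; [exact: mb|exact: mb'].
  - by case=> <-; exact: mb.
  - by case=> <-; exact: mb'.
apply/seteqP; split=> s.
  move=> [sc sc'] k _; rewrite /c''.
  have bP : if b k is Some p then point_event k p.1 p.2 s else True.
    by rewrite /b; case: ifP => // kn; have := sc k kn; case: (c k).
  have b'P : if b' k is Some p then point_event k p.1 p.2 s else True.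
    by rewrite /b'; case: ifP => // kn; have := sc' k kn; case: (c' k).
  case: (b k) bP => [p|] //; case: (b' k) b'P => [p'|] //.
  by move=> [_ xp' Cp'] [sk xp Cp]; split => //=; rewrite le_min xp.
move=> sc; split=> k kn; have := sc k; rewrite leq_max kn ?orbT => /(_ isT);
  rewrite /c'' /b /b' kn.
  case: (c k) => [p|] //; case: ifP => _ //; case: (c' k) => [p'|] //.
  by move=> [h1 + [h3 h4]] /=; rewrite le_min => /andP[].
case: (c' k) => [p'|]; last by [].
by case: ifP => _ //; case: (c k) => [p|] // [h1 + [h3 h4]] /=; rewrite le_min => /andP[].
Qed.

Definition mseqType := g_sigma_algebraType cylinders.

Lemma measurable_point_event k t (C : set V) : measurable C ->
  @measurable _ mseqType (point_event k t C).
Proof.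
move=> mC; apply: sub_sigma_algebra.
exists k.+1, (fun k' => if k' == k then Some (t, C) else None); split.
  by move=> k' p; case: eqP => // _ [<-].
apply/seteqP; split=> s.
  by move=> ske k' _; case: eqP => // ->.
by move=> /(_ k (ltnSn k)); rewrite eqxx.
Qed.

Lemma measurable_mseq_present k : @measurable _ mseqType [set s : mseq | (s k).1].
Proof.
rewrite (_ : mkset _ = \bigcup_m point_event k m%:R setT).
  by apply: bigcupT_measurable => m; exact: measurable_point_event.
apply/seteqP; split=> s /=; last by case=> m _ [].
move=> sk; exists (Num.truncn (s k).2.1).+1 => //; split => //.
by rewrite ltW// truncnS_gt.
Qed.

Lemma measurable_location k :
  measurable_fun setT (fun s : mseqType => if (s k).1 then (s k).2.1 else 0).
Proof.
apply: (@measurability _ _ mseqType (measurableTypeR R) setT _ _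
  (RGenOInfty.measurableE R)).
move=> _ [_ [t ->] <-]; rewrite setTI.
(* An absent point is given location 0, so it lies at or below [t] exactly when [0 <= t]. *)
rewrite (_ : _ @^-1` _ = ~` (point_event k t setT `|`
    (if 0 <= t then ~` [set s : mseq | (s k).1] else set0))).
  apply: measurableC; apply: measurableU; first exact: measurable_point_event.
  by case: ifP => // _; apply: measurableC; exact: measurable_mseq_present.
apply/seteqP; split=> s /=; rewrite in_itv/= andbT.
  case: ifP => sk tx; first last.
    by case=> [[]|]; [rewrite sk|rewrite leNgt tx].
  by case=> [[_ + _]|]; [rewrite leNgt tx|case: ifP => //= _; exact].
move/not_orP => [npt n0]; case: ifP => sk.
  by rewrite ltNge; apply/negP => xt; apply: npt.
rewrite ltNge; apply/negP => t0; apply: n0; rewrite t0 /=.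
by rewrite sk.
Qed.

Lemma measurable_mark k :
  measurable_fun setT (fun s : mseqType => if (s k).1 then (s k).2.2 else point).
Proof.
move=> _ C mC; rewrite setTI.
have mbC : @measurable _ mseqType [set s : mseq | (s k).1 /\ C (s k).2.2].
  rewrite (_ : mkset _ = \bigcup_m point_event k m%:R C).
    by apply: bigcupT_measurable => m; exact: measurable_point_event.
  apply/seteqP; split=> s /=; last by case=> m _ [].
  move=> [sk Cs]; exists (Num.truncn (s k).2.1).+1 => //; split => //.
  by rewrite ltW// truncnS_gt.
rewrite (_ : _ @^-1` _ = [set s : mseq | (s k).1 /\ C (s k).2.2] `|`
  (if `[< C point >] then ~` [set s : mseq | (s k).1] else set0)).
  apply: measurableU => //.
  by case: ifP => // _; apply: measurableC; exact: measurable_mseq_present.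
apply/seteqP; split=> s /=.
  case: ifP => sk Cs; first by left.
  by right; rewrite asboolT//= sk.
by case=> [[-> //]|]; case: asboolP => //= C0 /negP/negbTE ->.
Qed.

Definition relabelling (s s' : mseq) := exists2 r : nat -> nat,
  set_bij [set j : nat | (s j).1 : Prop] [set k : nat | (s' k).1 : Prop] r &
  forall j, (s j).1 -> s' (r j) = s j.

End sequence_space.

Lemma g_sigma_algebra_setI (T : pointedType) (G : set_system T) :
  setI_closed <<s G >>.
Proof. by move=> A B; exact: (@measurableI _ (g_sigma_algebraType G)). Qed.

Lemma g_sigma_algebra_setT (T : pointedType) (G : set_system T) : <<s G >> setT.
Proof. exact: (@measurableT _ (g_sigma_algebraType G)). Qed.

Lemma counting_lty (R : realType) (A : set nat) :
  (counting A < +oo :> \bar R)%E -> finite_set A.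
Proof. by rewrite /counting; case: asboolP. Qed.

Lemma has_rank_exists (R : realType) (e : set nat) (x : nat -> R) j :
  finite_set [set i | e i /\ x i <= x j] -> e j -> exists k, has_rank e x k j.
Proof.
move=> fin ej; have finp : finite_set [set i | precedes e x i j].
  apply: sub_finite_set fin => i [ei [xij|[xij _]]]; split => //; first exact: ltW.
  by rewrite xij.
by eexists; split => //; rewrite /counting asboolT.
Qed.

Lemma measurable_to_mseq d (T : measurableType d) (R : realType)
    dV (V : measurableType dV) (f : T -> mseqType R V) :
  (forall k t C, measurable C -> measurable (f @^-1` point_event k t C)) ->
  measurable_fun setT f.
Proof.
move=> mf; apply: (@measurability _ _ T (mseqType R V) setT f (@cylinders R _ V)) => //.
move=> _ [_ [n [c [mc ->]]] <-]; rewrite setTI.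
rewrite (_ : _ @^-1` _ = \bigcap_k (if (k < n)%N then
   if c k is Some p then f @^-1` point_event k p.1 p.2 else setT else setT)).
  apply: bigcapT_measurable => k; case: ifP => // _.
  by case ck : (c k) => [p|] //; exact: mf (mc _ _ ck).
apply/seteqP; split=> w /= H k.
  by move=> _; case: ifP => // kn; have := H k kn; case: (c k).
by move=> kn; have := H k Logic.I; rewrite kn; case: (c k).
Qed.

(** * Marked Poisson processes and their ranked versions *)

Section marked_process.
Context d (T : measurableType d) dV (V : measurableType dV) (R : realType).
Context (P : probability T R) (mu : probability V R).
Variables (E : nat -> set T) (X : nat -> T -> R) (M : nat -> T -> V).
Variable Lam : set R -> \bar R.
Hypothesis mEX : forall j B, measurable B -> measurable (E j `&` X j @^-1` B).
Hypothesis mM : forall j, measurable_fun setT (M j).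
Hypothesis poisson : poisson_process P E X Lam.
Hypothesis Lam_fin : forall m : nat, (Lam `]-oo, m%:R] < +oo)%E.
Hypothesis M_law : forall j B, measurable B -> P (M j @^-1` B) = mu B.
Hypothesis M_indep : mutually_independent P (fun j => g_sigma_algebra_preimage (M j)).
Hypothesis points_M_indep : independent2 P (points_sigma E X)
  <<s \bigcup_j g_sigma_algebra_preimage (M j) >>.

Definition config w : mseq R V := fun j => (`[< E j w >], (X j w, M j w)).

Definition label k w := xget 0%N [set j | rank_event E X k j w].

Definition ranked w : mseq R V := fun k =>
  if `[< exists j, rank_event E X k j w >]
  then (true, (X (label k w) w, M (label k w) w)) else (false, (0, point)).

Let L k t j := rank_event E X k j `&` [set w | X j w <= t].

Let points_sigma_measurable : points_sigma E X `<=` measurable.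
Proof.
apply: smallest_sub; first exact: sigma_algebra_measurable.
by move=> _ [j [B [mB ->]]]; exact: mEX.
Qed.

Let measurable_L k t j : measurable (L k t j).
Proof. by apply: points_sigma_measurable; exact: points_sigma_rank. Qed.

Let preimage_config k t C : config @^-1` point_event k t C =
  (E k `&` X k @^-1` `]-oo, t]) `&` M k @^-1` C.
Proof.
apply/seteqP; split=> w /=.
  by move=> [/= /asboolP Ek Xk Ck]; rewrite in_itv.
by rewrite in_itv/= => -[[Ek Xk] Ck]; split => //; exact/asboolP.
Qed.

Let labelE k j w : rank_event E X k j w -> label k w = j.
Proof.
move=> kj; rewrite /label; case: xgetP => [i -> ki|/(_ j)//].
exact: has_rank_inj ki kj.
Qed.

Let preimage_ranked k t C : ranked @^-1` point_event k t C =
  \bigcup_j (L k t j `&` M j @^-1` C).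
Proof.
apply/seteqP; split=> w.
  rewrite /point_event/= /ranked; case: asboolP => [[j kj]|_] []// _ /=.
  by rewrite (labelE kj) => Xt Ct; exists j.
move=> [j _ [[kj Xt] Ct]]; rewrite /point_event/= /ranked asboolT; last by exists j.
by rewrite /= (labelE kj).
Qed.

Let preimageM j (B : set V) : measurable B -> measurable (M j @^-1` B).
Proof. by move=> mB; rewrite -[X in measurable X]setTI; exact: mM. Qed.

Lemma measurable_config : measurable_fun setT (config : T -> mseqType R V).
Proof.
apply: measurable_to_mseq => k t C mC; rewrite preimage_config.
by apply: measurableI; [exact: mEX|exact: preimageM].
Qed.

Lemma measurable_ranked : measurable_fun setT (ranked : T -> mseqType R V).
Proof.
apply: measurable_to_mseq => k t C mC; rewrite preimage_ranked.
apply: bigcupT_measurable => j.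
by apply: measurableI => //; exact: preimageM.
Qed.

Definition locally_finite : set T :=
  \bigcap_m [set w | (point_count E X `]-oo, m%:R] w < +oo)%E].

Let measurable_finite B : measurable B ->
  measurable [set w | (point_count E X B w < +oo)%E].
Proof.
move=> mB.
rewrite (_ : mkset _ = ~` [set w | point_count E X B w = count_value R None]).
  by apply: measurableC; exact: measurable_count_value.
apply/seteqP; split=> w /=; first by move=> + e; rewrite e.
by have [[k|] e] := point_count_value E X B w; rewrite e// => _; exact: ltry.
Qed.

Lemma measurable_locally_finite : measurable locally_finite.
Proof. by apply: bigcapT_measurable => m; exact: measurable_finite. Qed.

Lemma probability_locally_finite : P locally_finite = 1%E.
Proof.
pose F m := [set w | (point_count E X `]-oo, m%:R] w < +oo)%E].
have mF m : measurable (F m) by exact: measurable_finite.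
have P0 m : P (~` F m) = 0%E.
  by rewrite probability_setC// /F (poisson_finite mEX poisson)// subee.
have mlf := measurable_locally_finite.
rewrite -[locally_finite]setCK probability_setC; last exact: measurableC.
rewrite (_ : P (~` locally_finite) = 0%E) ?sube0//.
apply: measure_negligible; first exact: measurableC.
rewrite setC_bigcap; apply: negligible_bigcup => m.
by exists (~` F m); split => //; [exact: measurableC|exact: P0].
Qed.

Let locally_finite_set w t : locally_finite w ->
  finite_set [set j | E j w /\ X j w <= t].
Proof.
move=> /(_ (Num.truncn t).+1 Logic.I) /=; rewrite point_countE => /counting_lty.
apply: sub_finite_set => j [Ej Xt]; split => //=; rewrite in_itv/=.
by rewrite (le_trans Xt)// ltW// truncnS_gt.
Qed.

(** Local finiteness leaves every existing point with finitely many predecessors, hence with a rank;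
    sending each label to the rank of its point is the required bijection. *)
Lemma ranked_relabelling w : locally_finite w -> relabelling (config w) (ranked w).
Proof.
move=> lfw; pose r j := xget 0%N [set k | rank_event E X k j w].
have rE j : E j w -> rank_event E X (r j) j w.
  move=> Ej; have [k kj] := has_rank_exists
    (locally_finite_set (X j w) lfw : finite_set [set i | [set i | E i w] i /\ _]) Ej.
  by rewrite /r; case: xgetP => [i -> //|/(_ k)].
exists r; last first.
  move=> j /asboolP Ej; rewrite /ranked asboolT; last by exists j; exact: rE.
  by rewrite (labelE (rE _ Ej)) /config asboolT.
split.
- move=> j /= /asboolP Ej; rewrite /ranked asboolT//; exists j; exact: rE.
- move=> i j /[1!inE] /asboolP Ei /[1!inE] /asboolP Ej rij.
  by rewrite -(labelE (rE _ Ei)) rij (labelE (rE _ Ej)).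
- move=> k /=; rewrite /ranked; case: asboolP => // -[j kj] _.
  have Ej : E j w by case: kj.
  by exists j; [exact/asboolP|exact: has_rank_uniq (rE _ Ej) kj].
Qed.

(** The marks factor out by [relabelled_marks]. Where the process is locally finite, what remains on
    the locations is a condition on counts of rays by [rank_count]. The outcome thus involves the
    labelling only through counts. *)
Lemma probability_ranked_cylinder n (c : nat -> option (R * set V)) :
  (forall k p, c k = Some p -> measurable p.2) ->
  P (ranked @^-1` cylinder n c) =
  (P [set w | forall i : 'I_n, if c i is Some p then
       (i.+1%:R%:E <= point_count E X `]-oo, p.1] w)%E : Prop else True] *
   (\prod_(k <- iota 0 n | c k) fine (mu (odflt setT (omap snd (c k)))))%:E)%E.
Proof.
move=> mc; pose s := [seq k <- iota 0 n | c k].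
pose C k : set V := odflt setT (omap snd (c k)).
pose t k : R := odflt 0 (omap fst (c k)).
have mC k : measurable (C k).
  by rewrite /C; case ck : (c k) => [p|] //=; exact: mc ck.
have sP k : k \in s = c k && (k < n)%N by rewrite mem_filter mem_iota.
have -> : ranked @^-1` cylinder n c =
    \big[setI/setT]_(k <- s) \bigcup_j (L k (t k) j `&` M j @^-1` C k).
  rewrite -bigcap_seq; under eq_bigcapr do rewrite -preimage_ranked.
  apply/seteqP; split=> w /= H k.
    rewrite /= sP => /andP[ck kn]; have := H k kn.
    by rewrite /t /C; case: (c k) ck.
  move=> kn; have := H k; rewrite /= sP kn /t /C.
  by case: (c k) => // p; apply.
rewrite (@relabelled_marks _ _ _ _ _ P mu (points_sigma E X) M)//; last 6 first.
- exact: g_sigma_algebra_setI.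
- by move=> k j; exact: points_sigma_rank.
- move=> k i j _ _ [w [[ki _] [kj _]]]; exact: has_rank_inj ki kj.
- move=> k k' j kk'; apply/seteqP; split=> // w [[kj _] [k'j _]].
  by move/eqP: kk'; apply; exact: has_rank_uniq kj k'j.
- by rewrite filter_uniq// iota_uniq.
- exact: g_sigma_algebra_setT.
congr (_ * _)%E; last by rewrite big_filter.
apply: (eq_probability_as measurable_locally_finite) => //.
- apply: bigsetI_measurable => k _; apply: bigcupT_measurable => j.
  exact: measurable_L.
- rewrite (_ : mkset _ = \bigcap_(i in [set` 'I_n]) (if c i is Some p then
      [set w | (i.+1%:R%:E <= point_count E X `]-oo, p.1] w)%E] else setT)).
    apply: fin_bigcap_measurable => // i _; case: (c i) => [p|//].
    have mpc := measurable_point_count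
      (fun j => mEX j (measurable_itv (`]-oo, p.1]) : measurable `]-oo, p.1])).
    rewrite -[X in measurable X]setTI.
    exact: emeasurable_fun_c_infty.
  apply/seteqP; split=> w /= H i; last by have := H i isT; case: (c i).
  by move=> _; have := H i; case: (c i).
- exact: probability_locally_finite.
move=> w lfw; rewrite -bigcap_seq.
have rk k u : (exists j, L k u j w) <->
    (k.+1%:R%:E <= point_count E X `]-oo, u] w)%E.
  rewrite point_countE.
  rewrite (_ : [set j | _] = [set j | E j w /\ X j w <= u]).
    exact: (rank_count k (locally_finite_set u lfw)).
  by apply/seteqP; split=> j /= [Ej]; rewrite in_itv/=.
split=> [H i|H k].
  case ci : (c i) => [p|//]; apply/rk.
  have [|j _ Lj] := H i; first by rewrite /= sP ci ltn_ord.
  by exists j; move: Lj; rewrite /t ci.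
rewrite /= sP => /andP[ck kn]; have := H (Ordinal kn) => /=.
rewrite /t; case: (c k) ck => [p|//] _ /rk[j Lj]; by exists j.
Qed.

End marked_process.

Section same_law.
Context d1 (T1 : measurableType d1) d2 (T2 : measurableType d2).
Context dV (V : measurableType dV) (R : realType).
Context (P1 : probability T1 R) (P2 : probability T2 R) (mu : probability V R).
Variables (E1 : nat -> set T1) (X1 : nat -> T1 -> R) (M1 : nat -> T1 -> V).
Variables (E2 : nat -> set T2) (X2 : nat -> T2 -> R) (M2 : nat -> T2 -> V).
Variable Lam : set R -> \bar R.
Hypothesis Lam_fin : forall m : nat, (Lam `]-oo, m%:R] < +oo)%E.
Hypothesis mEX1 : forall j B, measurable B -> measurable (E1 j `&` X1 j @^-1` B).
Hypothesis mM1 : forall j, measurable_fun setT (M1 j).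
Hypothesis poisson1 : poisson_process P1 E1 X1 Lam.
Hypothesis M1_law : forall j B, measurable B -> P1 (M1 j @^-1` B) = mu B.
Hypothesis M1_indep : mutually_independent P1 (fun j => g_sigma_algebra_preimage (M1 j)).
Hypothesis points_M1_indep : independent2 P1 (points_sigma E1 X1)
  <<s \bigcup_j g_sigma_algebra_preimage (M1 j) >>.
Hypothesis mEX2 : forall j B, measurable B -> measurable (E2 j `&` X2 j @^-1` B).
Hypothesis mM2 : forall j, measurable_fun setT (M2 j).
Hypothesis poisson2 : poisson_process P2 E2 X2 Lam.
Hypothesis M2_law : forall j B, measurable B -> P2 (M2 j @^-1` B) = mu B.
Hypothesis M2_indep : mutually_independent P2 (fun j => g_sigma_algebra_preimage (M2 j)).
Hypothesis points_M2_indep : independent2 P2 (points_sigma E2 X2)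
  <<s \bigcup_j g_sigma_algebra_preimage (M2 j) >>.

(** A Dynkin argument from the cylinders, which are stable under intersection. On a cylinder the
    factor from the marks depends on [mu] only, and the factor from the counts is the same by
    [poisson_same_counts]. *)
Lemma ranked_same_law (Z : set (mseqType R V)) : measurable Z ->
  P1 (ranked E1 X1 M1 @^-1` Z) = P2 (ranked E2 X2 M2 @^-1` Z).
Proof.
have mr1 := measurable_ranked mEX1 mM1; have mr2 := measurable_ranked mEX2 mM2.
have pre1 A : @measurable _ (mseqType R V) A -> measurable (ranked E1 X1 M1 @^-1` A).
  by move=> mA; rewrite -[X in measurable X]setTI; exact: mr1.
have pre2 A : @measurable _ (mseqType R V) A -> measurable (ranked E2 X2 M2 @^-1` A).
  by move=> mA; rewrite -[X in measurable X]setTI; exact: mr2.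
move: Z; apply: (@dynkin_induction _ (mseqType R V) (@cylinders R _ V)
  (fun Z => P1 (ranked E1 X1 M1 @^-1` Z) = P2 (ranked E2 X2 M2 @^-1` Z))) => //.
- exact: cylinders_setI.
- by rewrite !preimage_setT !probability_setT.
- move=> _ [n [c [mc ->]]].
  rewrite (probability_ranked_cylinder mEX1 mM1 poisson1 Lam_fin M1_law)//.
  rewrite (probability_ranked_cylinder mEX2 mM2 poisson2 Lam_fin M2_law)//.
  congr (_ * _)%E.
  (* A free coordinate receives the empty set, on whose count [Q] puts no condition. *)
  pose B (i : 'I_n) : set R := if c i is Some p then `]-oo, p.1]%classic else set0.
  pose Q : set ('I_n -> \bar R) := [set f | forall i : 'I_n,
    if c i is Some p then (i.+1%:R%:E <= f i)%E : Prop else True].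
  have mB i : measurable (B i) by rewrite /B; case: (c i).
  have QE d (T : measurableType d) (E : nat -> set T) (X : nat -> T -> R) :
      [set w | forall i : 'I_n, if c i is Some p then
         (i.+1%:R%:E <= point_count E X `]-oo, p.1] w)%E : Prop else True] =
      [set w | Q (fun i => point_count E X (B i) w)].
    by apply/seteqP; split=> w /= H i; have := H i; rewrite /B; case: (c i).
  rewrite (QE _ _ E1 X1) (QE _ _ E2 X2).
  exact: (poisson_same_counts mEX1 mEX2 poisson1 poisson2 Q mB).
- move=> A mA PA.
  have e1 := probability_setC P1 (pre1 A mA).
  have e2 := probability_setC P2 (pre2 A mA).
  exact: etrans e1 (etrans (congr1 (fun z => 1 - z)%E PA) (esym e2)).
- move=> F mF tF PF.
  have t1 : trivIset setT (fun k => ranked E1 X1 M1 @^-1` F k).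
    by move=> i j _ _ [w [Fi Fj]]; apply: tF => //; exists (ranked E1 X1 M1 w).
  have t2 : trivIset setT (fun k => ranked E2 X2 M2 @^-1` F k).
    by move=> i j _ _ [w [Fi Fj]]; apply: tF => //; exists (ranked E2 X2 M2 w).
  have m1 k := pre1 _ (mF k); have m2 k := pre2 _ (mF k).
  have e1 := measure_bigcup P1 setT _ (fun k _ => m1 k) t1.
  have e2 := measure_bigcup P2 setT _ (fun k _ => m2 k) t2.
  rewrite !preimage_bigcup; apply: etrans e1 (etrans _ (esym e2)).
  by apply: eq_eseriesr => k _; exact: PF.
Qed.

(** Almost surely the sequence and its ranked version are relabellings of each other, which an
    invariant event cannot tell apart. *)
Lemma marked_same_law (Z : set (mseqType R V)) : measurable Z ->
  (forall s s' : mseq R V, relabelling s s' -> Z s <-> Z s') ->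
  P1 (config E1 X1 M1 @^-1` Z) = P2 (config E2 X2 M2 @^-1` Z).
Proof.
move=> mZ Zinv.
have as_ranked d (T : measurableType d) (P : probability T R) (E : nat -> set T)
    (X : nat -> T -> R) (M : nat -> T -> V)
    (mEX : forall j B, measurable B -> measurable (E j `&` X j @^-1` B))
    (mM : forall j, measurable_fun setT (M j))
    (poisson : poisson_process P E X Lam) :
    P (config E X M @^-1` Z) = P (ranked E X M @^-1` Z).
  apply: (eq_probability_as (measurable_locally_finite mEX)).
  - rewrite -[X in measurable X]setTI.
    by apply: (measurable_config mEX mM).
  - rewrite -[X in measurable X]setTI.
    by apply: (measurable_ranked mEX mM).
  - exact: probability_locally_finite mEX poisson Lam_fin.
  - by move=> w lfw; apply: Zinv; exact: ranked_relabelling.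
by rewrite !as_ranked//; exact: ranked_same_law.
Qed.

End same_law.

(** * Received powers *)

Section measurable_inverse.
Context (R : realType).

Lemma measurable_invr : measurable_fun setT (@GRing.inv R).
Proof.
pose D : set R := ~` [set 0].
have oD : open D by rewrite openC; exact: closed_eq.
have mD : measurable_fun D (@GRing.inv R).
  apply: open_continuous_measurable_fun => // x /[1!inE] x0.
  by apply: inv_continuous; apply/eqP.
rewrite -(setvU [set 0]); apply/measurable_funU => //.
- exact: measurableC.
- by split => //; exact: measurable_fun_set1.
Qed.

Lemma measurable_inve : measurable_fun setT (@inve R).
Proof.
have meq (c : \bar R) : measurable_fun setT (fun x : \bar R => x == c).
  apply: (measurable_fun_bool true); rewrite setTI.
  rewrite (_ : _ @^-1` _ = [set c]); first exact: emeasurable_set1.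
  by apply/seteqP; split=> x /= /eqP.
(* The last branch is also right at [+oo]: [fine] sends it to 0, whose inverse in [R] is 0. *)
rewrite (_ : @inve R = (fun x => if x == 0%E then +oo%E else
    if x == -oo%E then -oo%E else ((fine x)^-1)%:E)).
  apply: measurable_fun_ifT => //; apply: measurable_fun_ifT => //.
  apply/measurable_EFinP; apply: measurableT_comp => //; exact: measurable_invr.
apply/funext => -[x| |] //=; last by rewrite /inve invr0.
Qed.

End measurable_inverse.

(** * Counts and SINR as functionals of a power sequence *)

Section power_sequences.
Context {R : realType}.
Implicit Types y : nat -> bool * R.

Definition pcount (B : set R) y : \bar R :=
  (\sum_(0 <= k <oo) (((y k).1 && ((y k).2 \in B))%:R)%:E)%E.

Definition pinterference i y : \bar R := (\sum_(0 <= j <oo | j != i) ((y j).2)%:E)%E.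

Definition psinr (eta : R) i y : \bar R :=
  (((y i).2)%:E / (pinterference i y + eta%:E))%E.

Definition count_event n (B : 'I_n -> set R) (C : 'I_n -> set (\bar R)) :
  set (nat -> bool * R) := [set y | forall i, C i (pcount (B i) y)].

Definition sinr_event (eta : R) (B : set (\bar R)) : set (nat -> bool * R) :=
  [set y : nat -> bool * R | exists i, [/\ (y i).1 : Prop,
    forall j, (y j).1 -> (y j).2 <= (y i).2 & B (psinr eta i y)]].

(** Power 0 at absent indices turns sums over all indices into sums over points, and nonnegativity
    makes these sums independent of the order. *)
Definition admissible y := forall k, 0 <= (y k).2 /\ (~~ (y k).1 -> (y k).2 = 0).

Definition prelabelling y y' (r : nat -> nat) :=
  set_bij [set j : nat | (y j).1 : Prop] [set k : nat | (y' k).1 : Prop] r /\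
  forall j, (y j).1 -> y' (r j) = y j.

(** Nonnegative series are unordered sums. Restricted to the present indices, where all nonzero
    terms are, they are reindexed by the bijection [r]. *)
Lemma prelabelling_sum y y' r (f : bool * R -> \bar R) (p p' : pred nat) :
  prelabelling y y' r ->
  (forall k, 0 <= f (y k))%E -> (forall k, 0 <= f (y' k))%E ->
  (forall k, ~~ (y k).1 -> f (y k) = 0%E) ->
  (forall k, ~~ (y' k).1 -> f (y' k) = 0%E) ->
  (forall j, (y j).1 -> p' (r j) = p j) ->
  (\sum_(0 <= k <oo | p k) f (y k) = \sum_(0 <= k <oo | p' k) f (y' k))%E.
Proof.
move=> [[rfun rinj rsurj] yr] f0 f0' fn fn' pr.
rewrite !nneseries_esum//.
have present z (q : pred nat) : (forall k, ~~ (z k).1 -> f (z k) = 0%E) ->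
    (\esum_(k in [set k | q k]) f (z k) =
     \esum_(k in [set k : nat | q k /\ (z k).1]) f (z k))%E.
  move=> zn; rewrite esum_mkcond [RHS]esum_mkcond; apply: eq_esum => k _.
  have [zk|zk] := boolP (z k).1; last by rewrite zn//; do 2 case: ifP.
  rewrite (_ : (k \in [set k | q k]) = (k \in [set k : nat | q k /\ (z k).1]))//.
  by apply/idP/idP => /[!inE]; [split|case].
rewrite (present y)// (present y')//.
rewrite (@reindex_esum R _ _ [set k : nat | p k /\ (y k).1]
  [set k : nat | p' k /\ (y' k).1] r (fun k => f (y' k))).
  by apply: eq_esum => j [_ yj]; rewrite yr.
split.
- by move=> j [pj yj]; split; [rewrite pr|exact: rfun].
- by move=> i j /[1!inE] -[_ yi] /[1!inE] -[_ yj]; apply: rinj; rewrite inE.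
- move=> k [pk yk]; have [j yj jk] := rsurj k yk.
  by exists j => //; split => //; rewrite -pr// jk.
Qed.

Lemma pcount_relabel B y y' r : prelabelling y y' r -> pcount B y = pcount B y'.
Proof.
move=> yy'; apply: (prelabelling_sum
  (f := fun v => ((v.1 && (v.2 \in B))%:R)%:E) yy') => //.
- by move=> k /negbTE /= ->.
- by move=> k /negbTE /= ->.
Qed.

Lemma psinr_relabel eta i y y' r : admissible y -> admissible y' ->
  prelabelling y y' r -> (y i).1 -> psinr eta i y = psinr eta (r i) y'.
Proof.
move=> ay ay' yy' yi; have [[rfun rinj _] yr] := yy'.
rewrite /psinr /pinterference yr//; congr (_ / (_ + _))%E.
apply: (prelabelling_sum (f := fun v => (v.2)%:E) yy').
- by move=> k /=; rewrite lee_fin; have [] := ay k.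
- by move=> k /=; rewrite lee_fin; have [] := ay' k.
- by move=> k yk /=; have [_ ->] := ay k.
- by move=> k yk /=; have [_ ->] := ay' k.
- move=> j yj; congr (~~ _); apply/eqP/eqP => [|->//].
  by apply: rinj; rewrite inE.
Qed.

Lemma count_event_relabel n (B : 'I_n -> set R) (C : 'I_n -> set (\bar R)) y y' r :
  prelabelling y y' r -> count_event B C y <-> count_event B C y'.
Proof.
by move=> yy'; split=> H i; have := H i; rewrite (pcount_relabel (B i) yy').
Qed.

Lemma sinr_event_relabel eta B y y' r : admissible y -> admissible y' ->
  prelabelling y y' r -> sinr_event eta B y <-> sinr_event eta B y'.
Proof.
move=> ay ay' yy'; have [[rfun rinj rsurj] yr] := yy'; split.
  move=> [i [yi imax Bi]]; exists (r i); split.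
  - exact: rfun.
  - move=> k yk; have [j yj jk] := rsurj k yk.
    by rewrite -jk !yr//; exact: imax.
  - by rewrite -(psinr_relabel _ ay ay' yy').
move=> [k [yk kmax Bk]]; have [i yi ik] := rsurj k yk; exists i; split => //.
- by move=> j yj; rewrite -(yr _ yi) -(yr _ yj) ik; apply: kmax; exact: rfun.
- by rewrite (psinr_relabel _ ay ay' yy')// ik.
Qed.

(** The absolute value makes the result admissible for every sequence, including those with negative
    marks; on sequences coming from a system it has no effect, by [scs_power_seqE]. *)
Definition power_seq (g : R -> R) (s : mseq R (R * R)%type) k : bool * R :=
  ((s k).1, if (s k).1 then `|(s k).2.2.1 * (s k).2.2.2 / g (s k).2.1| else 0).

Lemma power_seq_admissible g s : admissible (power_seq g s).
Proof.
by move=> k; split => /=; [case: ifP|move/negbTE ->].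
Qed.

Lemma power_seq_relabel g s s' : relabelling s s' ->
  exists r, prelabelling (power_seq g s) (power_seq g s') r.
Proof.
move=> [r rbij rs]; exists r; split; first exact: rbij.
by move=> j sj; rewrite /power_seq rs.
Qed.

Lemma measurable_power_seq (g : R -> R) k : measurable_fun setT g ->
  measurable_fun setT (fun s : mseqType R (R * R)%type => (power_seq g s k).2).
Proof.
move=> mg.
pose x (s : mseqType R (R * R)%type) := if (s k).1 then (s k).2.1 else 0.
pose m (s : mseqType R (R * R)%type) := if (s k).1 then (s k).2.2 else point.
have mx : measurable_fun setT x by exact: measurable_location.
have mm : measurable_fun setT m by exact: measurable_mark.
rewrite (_ : (fun s => _) =
    (fun s : mseqType R (R * R)%type => if (s k).1 then `|(m s).1 * (m s).2 / g (x s)| else 0)).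
  apply: measurable_fun_ifT => //.
    apply: (measurable_fun_bool true); rewrite setTI.
    exact: (@measurable_mseq_present R _ (R * R)%type k).
  apply: measurableT_comp => //; apply: measurable_funM.
    apply: measurable_funM.
      by apply: measurableT_comp mm; exact: measurable_fst.
    by apply: measurableT_comp mm; exact: measurable_snd.
  apply: measurableT_comp; first exact: measurable_invr.
  exact: measurableT_comp.
by apply/funext => s; rewrite /power_seq /m /x /=; case: (s k).1.
Qed.

Lemma measurable_count_event g n (B : 'I_n -> set R) (C : 'I_n -> set (\bar R)) :
  measurable_fun setT g ->
  (forall i, measurable (B i)) -> (forall i, measurable (C i)) ->
  @measurable _ (mseqType R (R * R)%type) (power_seq g @^-1` count_event B C).
Proof.
move=> mg mB mC.
rewrite (_ : _ @^-1` _ = \bigcap_(i in [set` 'I_n])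
  [set s : mseqType R (R * R)%type | C i (pcount (B i) (power_seq g s))]).
  apply: fin_bigcap_measurable => // i _; rewrite -[X in measurable X]setTI.
  suff mc : measurable_fun setT
    (fun s : mseqType R (R * R)%type => pcount (B i) (power_seq g s)) by exact: mc.
  apply: ge0_emeasurable_sum => [k s _ _|k _]; first by rewrite lee_fin.
  apply/measurable_EFinP.
  pose A : set (mseqType R (R * R)%type) := [set s : mseq R (R * R)%type | (s k).1] `&`
    (fun s => (power_seq g s k).2) @^-1` B i.
  rewrite (_ : (fun s => _) = \1_A).
    apply: measurable_indic; apply: measurableI.
      exact: (@measurable_mseq_present R _ (R * R)%type k).
    rewrite -[X in measurable X]setTI.
    exact: (measurable_power_seq k mg measurableT (mB i)).
  apply/funext => s; rewrite indicE; congr (_%:R); congr nat_of_bool.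
  apply/idP/idP => [/andP[sk /set_mem sB]|]; first by rewrite inE.
  by rewrite inE => -[sk sB]; apply/andP; split => //; exact/mem_set.
by apply/seteqP; split=> s /= H i; [move=> _|]; exact: H.
Qed.

Lemma measurable_sinr_event g eta (B : set (\bar R)) :
  measurable_fun setT g -> measurable B ->
  @measurable _ (mseqType R (R * R)%type) (power_seq g @^-1` sinr_event eta B).
Proof.
move=> mg mB; set W := mseqType R (R * R)%type.
pose f k (s : W) := (power_seq g s k).2.
have mf k : measurable_fun setT (f k) by exact: measurable_power_seq.
have mp k : @measurable _ W [set s : W | (s k).1].
  exact: (@measurable_mseq_present R _ (R * R)%type k).
rewrite (_ : _ @^-1` _ = \bigcup_i ([set s : W | (s i).1] `&`
    (\bigcap_j (~` [set s : W | (s j).1] `|` [set s : W | f j s <= f i s])) `&`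
    [set s : W | B (psinr eta i (power_seq g s))])).
  apply: bigcupT_measurable => i; apply: measurableI.
    apply: measurableI => //; apply: bigcapT_measurable => j.
    apply: measurableU; first exact: measurableC.
    by rewrite -[X in measurable X]setTI; exact: measurable_fun_le.
  rewrite -[X in measurable X]setTI.
  suff ms : measurable_fun setT (fun s : W => psinr eta i (power_seq g s)) by exact: ms.
  apply: emeasurable_funM; first by apply/measurable_EFinP; exact: mf.
  apply: measurableT_comp; first exact: measurable_inve.
  apply: emeasurable_funD => //.
  apply: ge0_emeasurable_sum => [k s _ _|k _].
    by rewrite lee_fin; have [] := power_seq_admissible g s k.
  by apply/measurable_EFinP; exact: mf.
apply/seteqP; split=> s.
  move=> [i [si imax Bi]]; exists i => //; split => //; split => // j _.
  by have [sj|sj] := boolP (s j).1; [right; exact: imax|left; exact/negP].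
move=> [i _ [[si imax] Bi]]; exists i; split => // j sj.
by have [|] := imax j Logic.I.
Qed.

End power_sequences.

(** * Images of Poisson processes *)

Section mapped_points.
Context d (T : measurableType d) (R : realType) (P : probability T R).
Variables (E : nat -> set T) (X : nat -> T -> R) (Lam : set R -> \bar R).
Variables (D : set R) (f : R -> R).
Hypothesis mf : forall B, measurable B -> measurable (D `&` f @^-1` B).

(** Points outside [D] are deleted, as [f] is meaningful only on [D]; in the application [D] is the
    range of [h] and [f] is [hinv]. *)
Definition mapped_present j : set T := E j `&` X j @^-1` D.

Definition mapped_location j w : R := f (X j w).

Lemma mapped_preimage j B : mapped_present j `&` mapped_location j @^-1` B =
  E j `&` X j @^-1` (D `&` f @^-1` B).
Proof. by rewrite /mapped_present -setIA. Qed.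

Lemma point_count_mapped B :
  point_count mapped_present mapped_location B = point_count E X (D `&` f @^-1` B).
Proof.
apply/funext => w; rewrite /point_count.
by under eq_eseriesr do rewrite mapped_preimage.
Qed.

(** The mapping theorem: counts of image points are counts of original points in preimages, and
    preimages of disjoint sets are disjoint. *)
Lemma poisson_mapped (Lam' : set R -> \bar R) :
  (forall B, measurable B -> Lam' B = Lam (D `&` f @^-1` B)) ->
  poisson_process P E X Lam -> poisson_process P mapped_present mapped_location Lam'.
Proof.
move=> LamE [ind pk poo]; split.
- move=> n B mB tB; under eq_fun do rewrite point_count_mapped.
  apply: ind => [i|]; first exact: mf.
  move=> i j _ _ [x [[_ Bi] [_ Bj]]]; apply: tB => //.
  by exists (f x).
- move=> B k mB; rewrite LamE// => LB; rewrite -pk//; last exact: mf.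
  by rewrite point_count_mapped.
- move=> B mB; rewrite LamE// => LB; rewrite -[RHS](poo (D `&` f @^-1` B))//; last exact: mf.
  by rewrite point_count_mapped.
Qed.

Lemma points_sigma_mapped :
  points_sigma mapped_present mapped_location `<=` points_sigma E X.
Proof.
apply: smallest_sub; first exact: smallest_sigma_algebra.
move=> _ [j [B [mB ->]]]; apply: sub_sigma_algebra.
by exists j, (D `&` f @^-1` B); split; [exact: mf|exact: mapped_preimage].
Qed.

End mapped_points.

(** * Shotgun cellular systems as power sequences *)

Section scs_powers.
Context d (T : measurableType d) (R : realType) (P : probability T R).
Context (lam : R -> R) (mu : probability (R * R)%type R).
Variables (S : scs P lam mu) (h : R -> R).

Definition scs_power_seq w k : bool * R :=
  (`[< present S k w >], if `[< present S k w >] then power S h k w else 0).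

Lemma power_countE B w : power_count S h B w = pcount B (scs_power_seq w).
Proof.
apply: eq_eseriesr => k _; rewrite indicE; congr (_%:R%:E); congr nat_of_bool.
rewrite /scs_power_seq /=; case: asboolP => Ek /=; last by rewrite memNset// => -[].
by apply/idP/idP => [/set_mem[_ /mem_set]//|/set_mem kB]; apply/mem_set; split.
Qed.

Lemma sinr_eventE eta B :
  [set w | exists2 i, serving S h w i & B (sinr S h eta i w)] =
  scs_power_seq @^-1` sinr_event eta B.
Proof.
have interE i w : interference S h i w = pinterference i (scs_power_seq w).
  apply: eq_eseriesr => j _; rewrite indicE /scs_power_seq /=.
  case: asboolP => Ej; first by rewrite mem_set// mul1r.
  by rewrite memNset// mul0r.
have sinrE i w : present S i w -> sinr S h eta i w = psinr eta i (scs_power_seq w).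
  by move=> Ei; rewrite /sinr /psinr interE /scs_power_seq /= asboolT.
apply/seteqP; split=> w.
  move=> [i [Ei imax] Bi]; exists i; split; first by apply/asboolP.
    move=> j /asboolP Ej; rewrite /scs_power_seq /= !asboolT//; exact: imax.
  by rewrite -sinrE.
move=> [i [/asboolP Ei imax Bi]]; exists i; last by rewrite sinrE.
split => // j Ej; have := imax j; rewrite /scs_power_seq /= !asboolT//; exact.
Qed.

(** Agreement of [g] with [h] at actual distances suffices, so [h] can be exchanged for a function
    measurable on the whole line. *)
Lemma scs_power_seqE (g : R -> R) w :
  (forall r, 0 <= r -> 0 <= h r) ->
  (forall j, present S j w -> g (distance S j w) = h (distance S j w)) ->
  scs_power_seq w =
  power_seq g (config (present S) (fun j => distance S j) (mark S) w).
Proof.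
move=> h0 gh; apply/funext => j; rewrite /scs_power_seq /power_seq /config /=.
case: asboolP => // Ej; rewrite gh//; congr (_, _); rewrite /power ger0_norm//.
by rewrite divr_ge0 ?mulr_ge0 ?txpower_ge0 ?fading_ge0// h0// distance_ge0.
Qed.

Lemma measurable_scs_points j B : measurable B ->
  measurable (present S j `&` distance S j @^-1` B).
Proof.
by move=> mB; apply: measurableI; [exact: measurable_present|exact: measurable_funPTI].
Qed.

Lemma measurable_scs_mark j : measurable_fun setT (mark S j).
Proof. by apply: measurable_fun_pair; exact: measurable_funPT. Qed.

End scs_powers.

(** * Comparison of the two systems *)

Section equivalence.
Context (R : realType) (h hinv lam : R -> R) (mu : probability (R * R)%type R).
Hypothesis h_ge0 : forall r, 0 <= r -> 0 <= h r.
Hypothesis h_incr : forall r s, 0 <= r -> r < s -> h r < h s.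
Hypothesis h_deriv : forall r, 0 < r -> derivable h r 1 /\ 0 < derive1 h r.
Hypothesis hinvK : forall r, 0 <= r -> hinv (h r) = r.
Hypothesis lam_ge0 : forall r, 0 <= r -> 0 <= lam r.
Hypothesis lam_locint : forall b, lebesgue_measure.-integrable `[0, b] (EFin \o lam).
Context d1 (T1 : measurableType d1) (P1 : probability T1 R).
Context d2 (T2 : measurableType d2) (P2 : probability T2 R).
Variables (S1 : scs P1 lam mu).
Variables (S2 : scs P2 (transformed_density h hinv lam) mu).

Let range_h : set R := h @` `[0, +oo[.

Let range_preimage B : range_h `&` hinv @^-1` B = h @` (B `&` `[0, +oo[).
Proof.
apply/seteqP; split=> [_ [[r r0 <-] /= Br]|_ [r [Br r0] <-]].
  have r0' : 0 <= r by move: r0; rewrite /= in_itv/= andbT.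
  by exists r => //; split => //; move: Br; rewrite hinvK.
have r0' : 0 <= r by move: r0; rewrite /= in_itv/= andbT.
by split; [exists r|rewrite /= hinvK].
Qed.

Let measurable_range_preimage B : measurable B ->
  measurable (range_h `&` hinv @^-1` B).
Proof.
by move=> mB; rewrite range_preimage; exact: (measurable_image_ray h_incr h_deriv hinvK).
Qed.

Let measurable_range : measurable range_h.
Proof. by have := measurable_range_preimage measurableT; rewrite preimage_setT setIT. Qed.

Let intensity_fin (m : nat) : (halfline_intensity lam `]-oo, m%:R] < +oo)%E.
Proof.
rewrite /halfline_intensity.
rewrite (_ : _ `&` _ = `[0, m%:R]%classic).
  by rewrite ltey_eq; apply/orP; left; exact: integrable_fin_num.
by apply/seteqP; split=> r /=; rewrite !in_itv/= andbT; [case=> -> ->|case/andP].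
Qed.

Let E2 := mapped_present (present S2) (fun j => distance S2 j) range_h.
Let X2 := mapped_location (fun j => distance S2 j) hinv.

Let poisson2 : poisson_process P2 E2 X2 (halfline_intensity lam).
Proof.
apply: (poisson_mapped measurable_range_preimage) (distance_poisson S2) => B mB.
rewrite range_preimage; apply/esym.
exact: (halfline_intensity_image h_incr h_deriv hinvK lam_ge0 lam_locint h_ge0).
Qed.

Let in_range : set T2 := [set w | forall j, present S2 j w -> range_h (distance S2 j w)].

Let measurable_in_range : measurable in_range.
Proof.
rewrite (_ : in_range = \bigcap_j ~` (present S2 j `&` distance S2 j @^-1` (~` range_h))).
  apply: bigcapT_measurable => j; apply: measurableC.
  by apply: measurable_scs_points; exact: measurableC.
apply/seteqP; split=> w H j; first by move=> _ [Ej]; apply; exact: H.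
by move=> Ej; apply: contrapT => nR; exact: (H j).
Qed.

(** The transformed density vanishes off the range of [h], and a Poisson count of mean 0 is almost
    surely 0. *)
Let probability_in_range : P2 in_range = 1%E.
Proof.
have [_ pk _] := distance_poisson S2.
have out0 := halfline_intensity_out h hinv lam.
have := pk (~` range_h) 0%N (measurableC measurable_range).
rewrite out0 => /(_ (ltry _)); rewrite /poisson_prob ltxx diracE mem_set// => <-.
congr (P2 _); apply/seteqP; split=> w /=.
  move=> wR; rewrite point_countE (_ : [set j | _] = set0) ?measure0//.
  by apply/seteqP; split=> // j [Ej]; apply; exact: wR.
rewrite point_countE => c0 j Ej; apply: contrapT => nR.
move: c0; rewrite /counting; case: asboolP => // fin [] /eqP; rewrite pnatr_eq0.
rewrite finmap.cardfs_eq0 => /eqP f0.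
have D0 := fset_set_set0 fin f0.
have : [set j | present S2 j w /\ (~` range_h) (distance S2 j w)] j by [].
by rewrite D0.
Qed.

(** The common form of both conclusions of the theorem, with [A] a count event or an SINR event.
    Measurability is asked for all [g] because the first system is read through [ht] and the second
    through the identity. *)
Lemma scs_same_law (A : set (nat -> bool * R)) :
  (forall g, measurable_fun setT g ->
    @measurable _ (mseqType R (R * R)%type) (power_seq g @^-1` A)) ->
  (forall y y' r, admissible y -> admissible y' -> prelabelling y y' r ->
    A y <-> A y') ->
  P1 (scs_power_seq S1 h @^-1` A) = P2 (scs_power_seq S2 id @^-1` A).
Proof.
move=> mA Ainv; pose ht (x : R) := h (Num.max x 0).
have mht : measurable_fun setT ht by exact: measurable_extension.
have htE x : 0 <= x -> ht x = h x by move=> x0; rewrite /ht (max_idPl x0).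
have seq1 w : scs_power_seq S1 h w =
    power_seq ht (config (present S1) (fun j => distance S1 j) (mark S1) w).
  by apply: scs_power_seqE => // j Ej; rewrite htE// distance_ge0.
have seq2 w : scs_power_seq S2 id w =
    power_seq id (config (present S2) (fun j => distance S2 j) (mark S2) w).
  exact: scs_power_seqE.
have mEX2 j B : measurable B -> measurable (E2 j `&` X2 j @^-1` B).
  by move=> mB; rewrite mapped_preimage; apply: measurable_scs_points;
    exact: measurable_range_preimage.
have -> : scs_power_seq S1 h @^-1` A =
    config (present S1) (fun j => distance S1 j) (mark S1) @^-1` (power_seq ht @^-1` A).
  by apply/seteqP; split=> w /=; rewrite seq1.
have ind2 : independent2 P2 (points_sigma E2 X2)
    <<s \bigcup_j g_sigma_algebra_preimage (mark S2 j) >>.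
  move=> B C sB sC; apply: (@mark_distance_independent _ _ _ _ _ _ S2); last exact: sC.
  exact: (points_sigma_mapped measurable_range_preimage) sB.
rewrite (marked_same_law intensity_fin
  (measurable_scs_points S1) (measurable_scs_mark S1)
  (@distance_poisson _ _ _ _ _ _ S1) (@mark_law _ _ _ _ _ _ S1)
  (@mark_independent _ _ _ _ _ _ S1)
  (@mark_distance_independent _ _ _ _ _ _ S1)
  mEX2 (measurable_scs_mark S2) poisson2 (@mark_law _ _ _ _ _ _ S2)
  (@mark_independent _ _ _ _ _ _ S2) ind2); first last.
- move=> s s' /(power_seq_relabel ht)[r]; apply: Ainv; exact: power_seq_admissible.
- exact: mA.
(* It remains to compare the second system pulled back by [hinv] and read through [ht] with the same
   system read directly. Where all distances lie in the range of [h], no point is deleted and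
   [h (hinv x) = x], so the powers coincide. *)
apply: (eq_probability_as measurable_in_range).
- rewrite -[X in measurable X]setTI.
  by apply: (measurable_config mEX2 (measurable_scs_mark S2)) => //; exact: mA.
- rewrite (_ : _ @^-1` _ = config (present S2) (fun j => distance S2 j) (mark S2) @^-1`
      (power_seq id @^-1` A)); last by apply/seteqP; split=> w /=; rewrite seq2.
  rewrite -[X in measurable X]setTI.
  apply: (measurable_config (measurable_scs_points S2) (measurable_scs_mark S2)) => //.
  by apply: mA; exact: measurable_id.
- exact: probability_in_range.
move=> w wR; rewrite /= seq2.
suff -> : power_seq ht (config E2 X2 (mark S2) w) =
  power_seq id (config (present S2) (fun j => distance S2 j) (mark S2) w) by [].
apply/funext => j; rewrite /power_seq /config /=.
have -> : `[< E2 j w >] = `[< present S2 j w >].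
  by apply/asboolP/asboolP => [[]//|Ej]; split => //; exact: wR.
case: asboolP => // Ej; congr (_, `|_ / _|).
rewrite /X2 /mapped_location; have [r r0 <-] := wR j Ej.
have r0' : 0 <= r by move: r0; rewrite /= in_itv/= andbT.
by rewrite hinvK// htE.
Qed.

End equivalence.

Theorem theorem1 (R : realType) (h hinv lam : R -> R)
  (mu : probability (R * R)%type R)
  (h_ge0 : forall r, 0 <= r -> 0 <= h r)
  (h_incr : forall r s, 0 <= r -> r < s -> h r < h s)
  (h_deriv : forall r, 0 < r -> derivable h r 1 /\ 0 < derive1 h r)
  (hinvK : forall r, 0 <= r -> hinv (h r) = r)
  (lam_ge0 : forall r, 0 <= r -> 0 <= lam r)
  (lam_locint : forall b, lebesgue_measure.-integrable `[0, b] (EFin \o lam))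
  (d1 : measure_display) (T1 : measurableType d1) (P1 : probability T1 R)
  (d2 : measure_display) (T2 : measurableType d2) (P2 : probability T2 R)
  (S1 : scs P1 lam mu)
  (S2 : scs P2 (transformed_density h hinv lam) mu) :
  scs_equivalent S1 h S2 id /\
  (forall eta : R, 0 <= eta -> same_sinr_law S1 h S2 id eta).
Proof.
have same := scs_same_law h_ge0 h_incr h_deriv hinvK lam_ge0 lam_locint S1 S2.
split=> [n B C mB mC|eta _ B mB].
  have E d (T : measurableType d) (P : probability T R) (l g : R -> R) (S : scs P l mu) :
      [set w | forall i, C i (power_count S g (B i) w)] =
      scs_power_seq S g @^-1` count_event B C.
    by apply/seteqP; split=> w /= H i; have := H i; rewrite power_countE.
  rewrite (E _ _ _ _ _ S1) (E _ _ _ _ _ S2); apply: same => [g mg|y y' r _ _].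
    exact: measurable_count_event.
  exact: count_event_relabel.
rewrite /sinr_law !sinr_eventE; apply: same => [g mg|y y' r].
  exact: measurable_sinr_event.
exact: sinr_event_relabel.
Qed.
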